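(* Suppose that $a_n\to\infty$, $\beta_n\to\beta_\infty$ as $n\to\infty$ with $|\beta_\infty|<1$, that $(\alpha_n')\in\ell^1(\mathbb Z_+)$, $(\beta_n')\in\ell^1(\mathbb Z_+)$, $(k_n-1)\in\ell^1$, and that $\sum_{n=0}^\infty a_n^{-1}=\infty$. Then, as $n\to\infty$, the orthonormal polynomials $P_n(\lambda)$ have the asymptotics $$P_n(\lambda)=a_n^{-1/2}\Big(\kappa(\lambda)(1-\beta_\infty^2)^{-1/2}\sin\big(\varphi_n(\lambda)+\eta(\lambda)\big)+o(1)\Big),\qquad \lambda\in\mathbb R,$$ where $\varphi_n(\lambda)=\sum_{m=N_0}^{n-1}\arccos(\alpha_m\lambda+\beta_m)$ and the amplitude $\kappa(\lambda)$ and phase $\eta(\lambda)$ are defined by $$\kappa(\lambda)=|\Omega(\lambda+i0)|,\qquad -\Omega(\lambda\pm i0)=\kappa(\lambda)e^{\pm i\eta(\lambda)}.$$ This relation is uniform in $\lambda$ on compact subintervals of $\mathbb R$.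
   Context: $\mathbb Z_+=\{0,1,2,\dots\}$; $a_n>0$ and $b_n\in\mathbb R$ for $n\in\mathbb Z_+$, and $a_{-1}>0$ is an arbitrary fixed number. For a sequence $x_n$ put $x_n'=x_{n+1}-x_n$. Notation: $$\alpha_n=\frac1{2\sqrt{a_{n-1}a_n}},\quad \beta_n=-\frac{b_n}{2\sqrt{a_{n-1}a_n}},\quad k_n=\frac{a_n}{\sqrt{a_{n-1}a_{n+1}}}.$$ The Jacobi equation is $a_{n-1}u_{n-1}+b_nu_n+a_nu_{n+1}=zu_n$, $n\in\mathbb Z_+$, for sequences $(u_n)_{n\ge-1}$. The polynomials $P_n(z)$ are its solution with $P_{-1}(z)=0$, $P_0(z)=1$. The Wronskian $\{u,v\}=a_n(u_nv_{n+1}-u_{n+1}v_n)$ of two solutions does not depend on $n\ge-1$. The branch of $\sqrt{z^2-1}$ on $\mathbb C\setminus[-1,1]$ is analytic and positive for $z>1$ (so equal to $\pm i\sqrt{1-\lambda^2}$ at $\lambda\pm i0$, $\lambda\in(-1,1)$); $\zeta(z)=z-\sqrt{z^2-1}$, $\zeta_n(z)=\zeta(\alpha_nz+\beta_n)$, with $\zeta_n(\lambda\pm i0)=\zeta(\alpha_n\lambda+\beta_n\pm i0)$ on the edges of the cut along $\mathbb R$. Given $\rho_0>0$, fix $0<\varepsilon_0<1-|\beta_\infty|$ and choose $N_0=N_0(\rho_0)\ge1$ such that $|\alpha_nz+\beta_n-\beta_\infty|<\varepsilon_0$ for all $n\ge N_0$, $|z|<\rho_0$. Put $q_n(z)=\zeta_{N_0}(z)\cdots\zeta_{n-1}(z)$,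 so that $q_n(\lambda\pm i0)=e^{\mp i\varphi_n(\lambda)}$. For $|z|<\rho_0$ in the complex plane cut along $\mathbb R$ (edges $\lambda\pm i0$ included), $f_n(z)$, $n\ge-1$, denotes the Jost solution: the unique solution of the Jacobi equation with $f_n(z)=a_n^{-1/2}q_n(z)(1+o(1))$ as $n\to\infty$. Finally $\Omega(z)=\{P(z),f(z)\}=-a_{-1}f_{-1}(z)$; one has $\Omega(\lambda-i0)=\overline{\Omega(\lambda+i0)}$. For a given compact set of $\lambda$, $\rho_0$ is taken larger than $\sup|\lambda|$. *)

(* Defs.v *)
From Stdlib Require Import Reals Lra Lia List ClassicalEpsilon.
From Coquelicot Require Import Coquelicot.

Open Scope R_scope.

(** Coefficients: [a n], [b n] for n >= 0, and the extra number a_{-1} is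
    [am1].  [aprev am1 a n] is a_{n-1}. *)
Definition aprev (am1 : R) (a : nat -> R) (n : nat) : R :=
  match n with O => am1 | S m => a m end.

Definition alpha (am1 : R) (a : nat -> R) (n : nat) : R :=
  / (2 * sqrt (aprev am1 a n * a n)).

Definition beta (am1 : R) (a b : nat -> R) (n : nat) : R :=
  - b n / (2 * sqrt (aprev am1 a n * a n)).

Definition kcoef (am1 : R) (a : nat -> R) (n : nat) : R :=
  a n / sqrt (aprev am1 a n * a (S n)).

(** Sequences (u_n)_{n >= -1} are functions [u : nat -> C] shifted by one:
    [u k] is u_{k-1}. *)
Definition jacobi_solution (am1 : R) (a b : nat -> R) (z : C) (u : nat -> C)
  : Prop :=
  forall n : nat,
    (aprev am1 a n * u n + b n * u (S n) + a n * u (S (S n)) = z * u (S n))%C.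

Fixpoint Psol (am1 : R) (a b : nat -> R) (z : C) (k : nat) : C :=
  match k with
  | O => RtoC 0
  | S m =>
      match m with
      | O => RtoC 1
      | S n =>
          (((z - b n) * Psol am1 a b z m - aprev am1 a n * Psol am1 a b z n)
             / a n)%C
      end
  end.

Lemma Psol_jacobi (am1 : R) (a b : nat -> R) (z : C) :
  (forall n, 0 < a n) -> jacobi_solution am1 a b z (Psol am1 a b z).
Proof.
  intros Ha n.
  change (Psol am1 a b z (S (S n))) with
    (((z - b n) * Psol am1 a b z (S n) - aprev am1 a n * Psol am1 a b z n)
       / a n)%C.
  field.
  intro H; apply RtoC_inj in H; specialize (Ha n); lra.
Qed.

Definition P (am1 : R) (a b : nat -> R) (n : nat) (z : C) : C :=
  Psol am1 a b z (S n).

(** [wronskian am1 a k u v] is the Wronskian {u,v} computed at n = k - 1. *)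
Definition wronskian (am1 : R) (a : nat -> R) (k : nat) (u v : nat -> C) : C :=
  (aprev am1 a k * (u k * v (S k) - u (S k) * v k))%C.

(** A point of the complex plane cut along R, edges included, is a pair of a
    side of the cut and a complex number [z]; the side matters only when [z] is
    real: ([Upper], lam) is lam + i0 and ([Lower], lam) is lam - i0. *)
Inductive side : Set := Upper | Lower.

Definition side_sign (s : side) : R :=
  match s with Upper => 1 | Lower => -1 end.

Definition im_sign (s : side) (z : C) : R :=
  if Rlt_dec 0 (Im z) then 1
  else if Rlt_dec (Im z) 0 then -1
  else side_sign s.

(** Principal square root, with its boundary values on the two edges of the
    cut (-oo, 0]. *)
Definition csqrt (s : side) (z : C) : C :=
  (sqrt ((Cmod z + Re z) / 2), im_sign s z * sqrt ((Cmod z - Re z) / 2)).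

(** The branch of sqrt (z^2 - 1), as the product of the principal roots of
    z - 1 and z + 1: the two cuts cancel on (-oo, -1), so the product is
    analytic off [-1, 1], and it is positive for z > 1. *)
Definition sqrt_z2m1 (s : side) (z : C) : C :=
  (csqrt s (z - RtoC 1) * csqrt s (z + RtoC 1))%C.

Lemma csqrt_sqr (s : side) (z : C) : (csqrt s z * csqrt s z = z)%C.
Proof.
  assert (HR : Rabs (Re z) <= Cmod z).
  { unfold Cmod, Re. rewrite <- sqrt_Rsqr_abs. apply sqrt_le_1_alt.
    unfold Rsqr. nra. }
  assert (Hp : 0 <= (Cmod z + Re z) / 2)
    by (revert HR; unfold Rabs; destruct Rcase_abs; lra).
  assert (Hm : 0 <= (Cmod z - Re z) / 2)
    by (revert HR; unfold Rabs; destruct Rcase_abs; lra).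
  assert (Hsq : Cmod z * Cmod z = Re z * Re z + Im z * Im z).
  { unfold Cmod. rewrite sqrt_sqrt by nra. unfold Re, Im. ring. }
  assert (Hprod : sqrt ((Cmod z + Re z) / 2) * sqrt ((Cmod z - Re z) / 2)
                  = Rabs (Im z) / 2).
  { rewrite <- sqrt_mult by assumption.
    replace ((Cmod z + Re z) / 2 * ((Cmod z - Re z) / 2))
      with (Rsqr (Im z / 2)) by (unfold Rsqr; nra).
    rewrite sqrt_Rsqr_abs. unfold Rdiv. rewrite Rabs_mult.
    rewrite (Rabs_pos_eq (/ 2)) by lra. reflexivity. }
  assert (Hs : im_sign s z * im_sign s z = 1).
  { unfold im_sign, side_sign; destruct Rlt_dec; [lra|];
      destruct Rlt_dec; [lra|]; destruct s; lra. }
  assert (Hsi : im_sign s z * Rabs (Im z) = Im z).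
  { unfold im_sign. destruct Rlt_dec; [rewrite Rabs_pos_eq; lra|].
    destruct Rlt_dec; [rewrite Rabs_left; lra|].
    replace (Im z) with 0 by lra. rewrite Rabs_R0. ring. }
  pose proof (sqrt_sqrt _ Hp) as E1. pose proof (sqrt_sqrt _ Hm) as E2.
  apply injective_projections; unfold csqrt, Cmult; cbn [fst snd];
    [change (fst z) with (Re z) | change (snd z) with (Im z)].
  - transitivity (sqrt ((Cmod z + Re z) / 2) * sqrt ((Cmod z + Re z) / 2)
      - (im_sign s z * im_sign s z)
        * (sqrt ((Cmod z - Re z) / 2) * sqrt ((Cmod z - Re z) / 2))); [ring|].
    rewrite E1, E2, Hs. field.
  - transitivity (2 * im_sign s z
      * (sqrt ((Cmod z + Re z) / 2) * sqrt ((Cmod z - Re z) / 2))); [ring|].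
    rewrite Hprod. transitivity (im_sign s z * Rabs (Im z)); [field|exact Hsi].
Qed.

Lemma sqrt_z2m1_edge (s : side) (x : R) :
  -1 < x < 1 ->
  sqrt_z2m1 s (RtoC x) = (0, side_sign s * sqrt (1 - x ^ 2)).
Proof.
  intros Hx.
  unfold sqrt_z2m1, csqrt, im_sign.
  rewrite <- RtoC_minus, <- RtoC_plus, !Cmod_R.
  simpl Re; simpl Im.
  rewrite (Rabs_left (x - 1)) by lra. rewrite (Rabs_pos_eq (x + 1)) by lra.
  destruct (Rlt_dec 0 0) as [H|_]; [lra|].
  replace ((- (x - 1) + (x - 1)) / 2) with 0 by field.
  replace ((- (x - 1) - (x - 1)) / 2) with (1 - x) by field.
  replace ((x + 1 + (x + 1)) / 2) with (1 + x) by field.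
  replace ((x + 1 - (x + 1)) / 2) with 0 by field.
  replace (1 - x ^ 2) with ((1 - x) * (1 + x)) by ring.
  rewrite sqrt_mult by lra. rewrite sqrt_0.
  unfold Cmult; simpl. f_equal; ring.
Qed.

Definition zeta (s : side) (z : C) : C := (z - sqrt_z2m1 s z)%C.

(** Since alpha_n > 0 and beta_n is real, z |-> alpha_n z + beta_n preserves the
    sides of the cut. *)
Definition zetan (am1 : R) (a b : nat -> R) (n : nat) (s : side) (z : C) : C :=
  zeta s (alpha am1 a n * z + beta am1 a b n)%C.

Definition q (am1 : R) (a b : nat -> R) (N0 n : nat) (s : side) (z : C) : C :=
  fold_right Cmult (RtoC 1)
    (map (fun m => zetan am1 a b m s z) (seq N0 (n - N0))).

Definition jost_asymptotics (am1 : R) (a b : nat -> R) (N0 : nat) (s : side)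
    (z : C) (f : nat -> C) : Prop :=
  exists r : nat -> C,
    is_lim_seq (fun n => Cmod (r n)) 0 /\
    eventually (fun n =>
      f (S n) = (/ sqrt (a n) * q am1 a b N0 n s z * (1 + r n))%C).

Definition is_jost (am1 : R) (a b : nat -> R) (N0 : nat) (s : side) (z : C)
    (f : nat -> C) : Prop :=
  jacobi_solution am1 a b z f /\ jost_asymptotics am1 a b N0 s z f.

(** "The unique solution such that ...": if there is no unique one, the value
    is arbitrary. *)
Definition jost (am1 : R) (a b : nat -> R) (N0 : nat) (s : side) (z : C)
  : nat -> C :=
  epsilon (inhabits (fun _ : nat => RtoC 0))
    (unique (is_jost am1 a b N0 s z)).

Definition Omega (am1 : R) (a b : nat -> R) (N0 : nat) (s : side) (z : C) : C :=
  wronskian am1 a 0 (Psol am1 a b z) (jost am1 a b N0 s z).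

Lemma OmegaE (am1 : R) (a b : nat -> R) (N0 : nat) (s : side) (z : C) :
  Omega am1 a b N0 s z = (- (am1 * jost am1 a b N0 s z 0%nat))%C.
Proof. unfold Omega, wronskian; simpl; ring. Qed.

Definition phi (am1 : R) (a b : nat -> R) (N0 n : nat) (lam : R) : R :=
  fold_right Rplus 0
    (map (fun m => acos (alpha am1 a m * lam + beta am1 a b m))
       (seq N0 (n - N0))).

Definition kappa (am1 : R) (a b : nat -> R) (N0 : nat) (lam : R) : R :=
  Cmod (Omega am1 a b N0 Upper (RtoC lam)).

Definition expi (t : R) : C := (cos t, sin t).

(** The phase is determined only modulo 2 pi, so it is given by the relation
    which defines it. *)
Definition is_phase (am1 : R) (a b : nat -> R) (N0 : nat) (rho0 : R)
    (eta : R -> R) : Prop :=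
  forall (s : side) (lam : R), Rabs lam < rho0 ->
    (- Omega am1 a b N0 s (RtoC lam)
     = kappa am1 a b N0 lam * expi (side_sign s * eta lam))%C.

(* Main.v *)
Require Import Defs.
From Stdlib Require Import Reals Lra Lia List ClassicalEpsilon FunctionalExtensionality.
From Coquelicot Require Import Coquelicot.
Open Scope R_scope.

(** For a real solution [u] of the Jacobi equation put [v_n = sqrt(a_n) u_n], so
    that [v_{n-1} + k_n v_{n+1} = 2 x_n v_n] with
    [x_n = alpha_n lam + beta_n = cos theta_n].  The quantity
    [h_n = q_n (v_{n+1} - zeta_n v_n)] satisfies
    [|h_{n+1} - h_n| <= e_n |h_n|] with [e_n] summable and independent of [lam],
    because [v_n sin theta_n = Im (conj q_n h_n)] recovers the real solution from
    [h_n]; so [h_n] converges uniformly in [lam], to [h(u)] say.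

    If [u] and [w] are the real solutions with initial values [(0, 1)] and [(1, 0)]
    at [(-1, 0)], constancy of their Wronskian shows that
    [(h(u) w - h(w) u) / a_{-1}] has the asymptotics required of the Jost
    solution.  Its value at [-1] is [h(u) / a_{-1}], hence [Omega = - h(u)], and
    the asymptotics of [P_n] is the limit of [v_n sin theta_n = Im (conj q_n h_n)]. *)

(** * Unit complex numbers and polar form *)

Lemma Cmod_le_Re_Im (z : C) : Cmod z <= Rabs (Re z) + Rabs (Im z).
Proof.
  replace z with (RtoC (Re z) + Ci * RtoC (Im z))%C at 1
    by (destruct z; unfold Re, Im; apply injective_projections; simpl; ring).
  eapply Rle_trans; [apply Cmod_triangle|].
  rewrite Cmod_mult, Cmod_Ci, !Cmod_R. lra.
Qed.

Lemma im_le_Cmod (z : C) : Rabs (Im z) <= Cmod z.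
Proof. eapply Rle_trans; [apply Rmax_r | apply Rmax_Cmod]. Qed.

Lemma expi_add (s t : R) : expi (s + t) = (expi s * expi t)%C.
Proof.
  unfold expi; rewrite cos_plus, sin_plus.
  apply injective_projections; simpl; ring.
Qed.

Lemma expi_mod (t : R) : Cmod (expi t) = 1.
Proof.
  unfold Cmod, expi; simpl.
  replace (cos t * (cos t * 1) + sin t * (sin t * 1)) with 1
    by (generalize (sin2_cos2 t); unfold Rsqr; lra).
  apply sqrt_1.
Qed.

Lemma expi_mul_opp (t : R) : (expi t * expi (- t) = 1)%C.
Proof.
  rewrite <- expi_add, Rplus_opp_r. unfold expi. rewrite cos_0, sin_0. reflexivity.
Qed.

Lemma expi_conj (t : R) : Cconj (expi t) = expi (- t).
Proof. unfold Cconj, expi; simpl. now rewrite cos_neg, sin_neg. Qed.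

(** [acos] of the normalized real part gives the angle up to sign, and the sign of the imaginary
    part decides between [acos x] and [- acos x]. For [w = 0] any angle works. *)
Lemma polar_form (w : C) : exists t : R, w = (RtoC (Cmod w) * expi t)%C.
Proof.
  destruct (Req_dec (Cmod w) 0) as [E | E].
  { exists 0. rewrite E, (Cmod_eq_0 _ E). ring. }
  pose proof (Cmod_ge_0 w) as Hge.
  set (m := Cmod w) in *.
  assert (Hsq : Re w ^ 2 + Im w ^ 2 = m ^ 2) by (symmetry; apply Cmod2_alt).
  set (x := Re w / m). set (y := Im w / m).
  assert (Hxy : x ^ 2 + y ^ 2 = 1).
  { unfold x, y. transitivity ((Re w ^ 2 + Im w ^ 2) / m ^ 2);
      [now field | rewrite Hsq; now field]. }
  assert (Hx : -1 <= x <= 1) by nra.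
  assert (Hs : sin (acos x) = Rabs y).
  { rewrite sin_acos by exact Hx. replace (1 - Rsqr x) with (Rsqr y)
      by (unfold Rsqr; lra). apply sqrt_Rsqr_abs. }
  assert (Hw : forall t, cos t = x -> sin t = y -> w = (RtoC m * expi t)%C).
  { intros t Hc Ht. unfold expi. rewrite Hc, Ht.
    destruct w as [w1 w2]. unfold x, y, Re, Im; simpl.
    apply injective_projections; simpl; now field. }
  destruct (Rle_dec 0 y) as [Hy | Hy].
  - exists (acos x). apply Hw; [now apply cos_acos |].
    rewrite Hs. apply Rabs_pos_eq, Hy.
  - exists (- acos x). apply Hw; [rewrite cos_neg; now apply cos_acos |].
    rewrite sin_neg, Hs, Rabs_left; lra.
Qed.

(** * Summable increments and a discrete Gronwall inequality *)

Lemma is_lim_seq_dominated (u v : nat -> R) :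
  eventually (fun n => Rabs (u n) <= v n) -> is_lim_seq v 0 -> is_lim_seq u 0.
Proof.
  intros H Hv. apply is_lim_seq_abs_0.
  apply (is_lim_seq_le_le_loc (fun _ => 0) _ v).
  - destruct H as [N H]. exists N. intros n Hn. split; [apply Rabs_pos | auto].
  - apply is_lim_seq_const.
  - exact Hv.
Qed.

(** Since [sum_n e n] includes the term [e n], subtracting it gives the sum of the first [n] terms,
    whose forward difference is exactly [e n]; the subtracted term tends to 0. *)
Lemma summable_primitive (e : nat -> R) :
  ex_series e ->
  exists (E : nat -> R) (L : R),
    (forall n, E (S n) - E n = e n) /\ is_lim_seq E L.
Proof.
  intros He. exists (fun n => sum_n e n - e n), (Series e). split.
  - intros n. rewrite sum_Sn. unfold plus; simpl. ring.
  - replace (Finite (Series e)) with (Finite (Series e - 0)) by (f_equal; ring).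
    apply is_lim_seq_minus'.
    + apply Series_correct, He.
    + now apply ex_series_lim_0.
Qed.

(** [h + E] increases and [h - E] decreases. The first is bounded, so it has a limit [l'], and the
    second then tends to [l' - 2 L]; the two monotone bounds enclose [h n] around [l' - L] with the
    explicit error [L - E n]. *)
Lemma cauchy_limit (h E : nat -> R) (L : R) :
  (forall n, Rabs (h (S n) - h n) <= E (S n) - E n) ->
  is_lim_seq E L ->
  exists l, forall n, Rabs (h n - l) <= L - E n.
Proof.
  intros Hh HE.
  assert (Hinc : forall n, E n <= E (S n)).
  { intros n. specialize (Hh n).
    pose proof (Rabs_pos (h (S n) - h n)). lra. }
  assert (HES : forall n, E n <= L)
    by (intro n; now apply (is_lim_seq_incr_compare E)).
  assert (Hup : forall n, h n - E n <= h 0%nat - E 0%nat).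
  { induction n as [|n IH]; [lra|]. specialize (Hh n).
    apply Rabs_le_between in Hh. lra. }
  assert (Hmono : forall n, h n + E n <= h (S n) + E (S n)).
  { intros n. specialize (Hh n). apply Rabs_le_between in Hh. lra. }
  destruct (ex_finite_lim_seq_incr (fun n => h n + E n)
              (h 0%nat - E 0%nat + 2 * L)) as [l' Hl'].
  - exact Hmono.
  - intros n. specialize (Hup n). specialize (HES n). lra.
  - exists (l' - L). intros n.
    pose proof (is_lim_seq_incr_compare _ _ Hl' Hmono n) as H1. simpl in H1.
    assert (H2 : is_lim_seq (fun n => h n - E n) (l' - L - L)).
    { apply (is_lim_seq_ext (fun n => (h n + E n) - E n - E n)).
      - intros m. ring.
      - apply is_lim_seq_minus'; [apply is_lim_seq_minus'|]; assumption. }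
    assert (H3 : l' - L - L <= h n - E n).
    { apply (is_lim_seq_decr_compare (fun n => h n - E n)); [exact H2|].
      intros m. specialize (Hh m). apply Rabs_le_between in Hh. lra. }
    apply Rabs_le. lra.
Qed.

(** By [1 + x <= exp x], relative increments [E (S n) - E n] keep [Cmod (h n)] below a constant [M],
    so the increments of [h] are at most those of [M * E]. Applying [cauchy_limit] to the real and
    imaginary parts produces the factor 2. The error depends on [h] only through [Cmod (h N)], which
    is what makes uniformity in [lam] possible. *)
Lemma discrete_gronwall (h : nat -> C) (E : nat -> R) (L : R) (N : nat) :
  (forall n, E n <= E (S n)) ->
  is_lim_seq E L ->
  (forall n, (N <= n)%nat ->
     Cmod (h (S n) - h n) <= (E (S n) - E n) * Cmod (h n)) ->
  exists l : C, forall n, (N <= n)%nat ->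
    Cmod (h n - l) <= Cmod (h N) * (exp (L - E N) * (2 * (L - E n))).
Proof.
  intros Hinc HE Hh.
  assert (HES : forall n, E n <= L)
    by (intro n; now apply (is_lim_seq_incr_compare E)).
  assert (Hg : forall j, Cmod (h (N + j)%nat)
                         <= Cmod (h N) * exp (E (N + j)%nat - E N)).
  { induction j as [|j IH].
    - rewrite Nat.add_0_r, Rminus_diag, exp_0. lra.
    - rewrite Nat.add_succ_r.
      specialize (Hh (N + j)%nat ltac:(lia)).
      set (x := E (S (N + j)) - E (N + j)%nat) in *.
      replace (E (S (N + j)) - E N)
        with (E (N + j)%nat - E N + x) by (unfold x; ring).
      rewrite exp_plus.
      pose proof (exp_ineq1_le x) as Hx.
      assert (0 <= x) by (unfold x; specialize (Hinc (N + j)%nat); lra).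
      assert (Ht : Cmod (h (S (N + j))) <= Cmod (h (N + j)%nat) * (1 + x)).
      { replace (h (S (N + j)))
          with (h (S (N + j)) - h (N + j)%nat + h (N + j)%nat)%C by ring.
        eapply Rle_trans; [apply Cmod_triangle|]. lra. }
      pose proof (Cmod_ge_0 (h (N + j)%nat)).
      pose proof (Cmod_ge_0 (h N)).
      pose proof (exp_pos (E (N + j)%nat - E N)).
      eapply Rle_trans; [exact Ht|].
      rewrite <- Rmult_assoc.
      apply Rmult_le_compat; lra. }
  set (M := Cmod (h N) * exp (L - E N)).
  assert (HM : forall j, Cmod (h (N + j)%nat) <= M).
  { intros j. eapply Rle_trans; [apply Hg|].
    apply Rmult_le_compat_l; [apply Cmod_ge_0|].
    destruct (Rle_lt_or_eq_dec (E (N + j)%nat) L (HES _)) as [Hlt | ->]; [|lra].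
    apply Rlt_le, exp_increasing. lra. }
  assert (HEM : is_lim_seq (fun j => M * E (N + j)%nat) (M * L)).
  { apply (is_lim_seq_scal_l (fun j => E (N + j)%nat) M L).
    apply (is_lim_seq_ext (fun j => E (j + N)%nat));
      [intro; f_equal; lia | now apply is_lim_seq_incr_n]. }
  assert (Hstep : forall j,
    Cmod (h (N + S j)%nat - h (N + j)%nat)
    <= M * E (N + S j)%nat - M * E (N + j)%nat).
  { intros j. rewrite Nat.add_succ_r.
    eapply Rle_trans; [apply Hh; lia|].
    specialize (HM j). specialize (Hinc (N + j)%nat).
    rewrite <- Rmult_minus_distr_l, Rmult_comm.
    apply Rmult_le_compat_r; lra. }
  destruct (fun H => cauchy_limit (fun j => Re (h (N + j)%nat)) _ _ H HEM)
    as [l1 Hl1].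
  { intros j. eapply Rle_trans; [|apply Hstep].
    eapply Rle_trans; [|apply re_le_Cmod]. apply Req_le. reflexivity. }
  destruct (fun H => cauchy_limit (fun j => Im (h (N + j)%nat)) _ _ H HEM)
    as [l2 Hl2].
  { intros j. eapply Rle_trans; [|apply Hstep].
    eapply Rle_trans; [|apply im_le_Cmod]. apply Req_le. reflexivity. }
  exists (l1, l2). intros n Hn.
  specialize (Hl1 (n - N)%nat). specialize (Hl2 (n - N)%nat).
  replace (N + (n - N))%nat with n in Hl1, Hl2 by lia.
  eapply Rle_trans; [apply Cmod_le_Re_Im|].
  change (Re (h n - (l1, l2))) with (Re (h n) - l1).
  change (Im (h n - (l1, l2))) with (Im (h n) - l2).
  unfold M in *. lra.
Qed.

(** * One step of the three-term recurrence with slowly varying angle *)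

(** From [sin^2 + cos^2 = 1], the product of difference and sum of the sines equals, up to sign,
    that of the cosines; the sum of the sines is at least [2 m] and that of the cosines at most
    2. *)
Lemma Rabs_sin_minus_le (s t m : R) :
  0 < m -> m <= sin s -> m <= sin t ->
  Rabs (sin t - sin s) <= / m * Rabs (cos t - cos s).
Proof.
  intros Hm Hs Ht.
  assert (H : Rabs (sin t - sin s) * m <= Rabs (cos t - cos s)).
  { assert (E : (sin t - sin s) * (sin t + sin s)
                = (cos s - cos t) * (cos t + cos s)).
    { generalize (sin2_cos2 s) (sin2_cos2 t); unfold Rsqr; lra. }
    assert (E' : Rabs (sin t - sin s) * (sin t + sin s)
                 = Rabs (cos t - cos s) * Rabs (cos t + cos s)).
    { rewrite <- (Rabs_pos_eq (sin t + sin s)) by lra.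
      rewrite <- !Rabs_mult, E, !Rabs_mult, (Rabs_minus_sym (cos s)). reflexivity. }
    assert (Rabs (cos t + cos s) <= 2).
    { apply Rabs_le. generalize (COS_bound s) (COS_bound t). lra. }
    pose proof (Rabs_pos (sin t - sin s)). pose proof (Rabs_pos (cos t - cos s)).
    nra. }
  apply (Rmult_le_reg_r m); [exact Hm|].
  replace (/ m * Rabs (cos t - cos s) * m) with (Rabs (cos t - cos s))
    by (field; lra).
  exact H.
Qed.

Lemma Cmod_expi_minus_le (s t m : R) :
  0 < m -> m <= sin s -> m <= sin t ->
  Cmod (expi (- s) - expi (- t)) <= (1 + / m) * Rabs (cos t - cos s).
Proof.
  intros Hm Hs Ht.
  eapply Rle_trans; [apply Cmod_le_Re_Im|].
  change (Re (expi (- s) - expi (- t))) with (cos (- s) - cos (- t)).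
  change (Im (expi (- s) - expi (- t))) with (sin (- s) - sin (- t)).
  rewrite !cos_neg, !sin_neg.
  rewrite (Rabs_minus_sym (cos s)).
  replace (- sin s - - sin t) with (sin t - sin s) by ring.
  pose proof (Rabs_sin_minus_le s t m Hm Hs Ht).
  lra.
Qed.

(** As [V] and [W] are real, the imaginary part of [W - expi (- t) * V] is [V * sin t]. In the
    companion bound for [W], multiplying first by the unit number [expi t] makes the imaginary part
    [W * sin t]. Thus one complex difference controls both real values. *)
Lemma Rabs_mul_sin_le_l (t V W : R) :
  Rabs (V * sin t) <= Cmod (W - expi (- t) * V).
Proof.
  eapply Rle_trans; [|apply im_le_Cmod]. apply Req_le. f_equal.
  unfold expi; simpl. rewrite sin_neg. ring.
Qed.

Lemma Rabs_mul_sin_le_r (t V W : R) :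
  Rabs (W * sin t) <= Cmod (W - expi (- t) * V).
Proof.
  rewrite <- (Rmult_1_l (Cmod _)), <- (expi_mod t), <- Cmod_mult.
  eapply Rle_trans; [|apply im_le_Cmod]. apply Req_le. f_equal.
  replace (expi t * (W - expi (- t) * V))%C with (expi t * W - V)%C.
  - unfold expi; simpl. ring.
  - transitivity (expi t * W - expi t * expi (- t) * V)%C; [|ring].
    rewrite expi_mul_opp. ring.
Qed.

Lemma Rabs_le_of_mult (v s m c : R) :
  0 < m -> m <= s -> Rabs (v * s) <= c -> Rabs v <= c / m.
Proof.
  intros Hm Hs H. rewrite Rabs_mult, (Rabs_pos_eq s) in H by lra.
  pose proof (Rabs_pos v).
  apply (Rmult_le_reg_r m); [exact Hm|].
  unfold Rdiv. rewrite Rmult_assoc, Rinv_l by lra. nra.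
Qed.

(** For [t = s] and [k = 1] the left side vanishes, because [expi (- t)] is then a root of the
    characteristic equation. In general the defect is a term in [V2] from the change of angle plus a
    term in [V3] from [k - 1], and both values are controlled by the previous difference. *)
Lemma recurrence_increment (s t k m V1 V2 V3 : R) :
  0 < m -> m <= sin s -> m <= sin t -> / 2 <= k ->
  V1 + k * V3 = 2 * cos t * V2 ->
  Cmod (expi (- s) * (V3 - expi (- t) * V2) - (V2 - expi (- s) * V1))
  <= ((1 + / m) * Rabs (cos t - cos s) + 6 * Rabs (k - 1)) * / m
     * Cmod (V2 - expi (- s) * V1).
Proof.
  intros Hm Hs Ht Hk Hrec.
  (* Substitute [V1] and use [2 cos t = expi t + expi (- t)]. *)
  assert (E : (expi (- s) * (V3 - expi (- t) * V2) - (V2 - expi (- s) * V1)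
             = expi t * (expi (- s) - expi (- t)) * V2
               - (k - 1)%R * expi (- s) * V3)%C).
  { assert (HV1 : RtoC V1 = ((expi t + expi (- t)) * V2 - k * V3)%C).
    { replace V1 with (2 * cos t * V2 - k * V3) by lra.
      rewrite RtoC_minus, !RtoC_mult.
      replace (RtoC 2 * cos t)%C with (expi t + expi (- t))%C; [reflexivity|].
      unfold expi; apply injective_projections; simpl;
        rewrite ?cos_neg, ?sin_neg; ring. }
    rewrite HV1, RtoC_minus.
    transitivity ((expi t * expi (- s)) * V2 - V2 - (k - 1) * expi (- s) * V3)%C;
      [ring|].
    transitivity ((expi t * expi (- s) - expi t * expi (- t)) * V2
                  - (k - 1) * expi (- s) * V3)%C; [|ring].
    rewrite expi_mul_opp. ring. }
  rewrite E. clear E.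
  set (Y := Cmod (V2 - expi (- s) * V1)).
  assert (HY : 0 <= Y) by apply Cmod_ge_0.
  assert (H1 : Rabs V1 <= Y / m)
    by (apply (Rabs_le_of_mult _ (sin s)); auto; apply Rabs_mul_sin_le_l).
  assert (H2 : Rabs V2 <= Y / m)
    by (apply (Rabs_le_of_mult _ (sin s)); auto; apply Rabs_mul_sin_le_r).
  (* The recurrence gives [k |V3| <= 2 |V2| + |V1| <= 3 Y / m], and [k >= 1/2] doubles the
     constant. *)
  assert (H3 : Rabs V3 <= 6 * (Y / m)).
  { apply (Rmult_le_reg_l k); [lra|].
    rewrite <- (Rabs_pos_eq k) at 1 by lra. rewrite <- Rabs_mult.
    replace (k * V3) with (2 * cos t * V2 + - V1) by lra.
    eapply Rle_trans; [apply Rabs_triang|].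
    rewrite Rabs_Ropp, !Rabs_mult, (Rabs_pos_eq 2) by lra.
    assert (Rabs (cos t) <= 1) by (apply Rabs_le, COS_bound).
    pose proof (Rabs_pos V2). pose proof (Rabs_pos (cos t)). nra. }
  eapply Rle_trans; [apply Cmod_triangle|].
  rewrite Cmod_opp, !Cmod_mult, !expi_mod, !Cmod_R.
  pose proof (Cmod_expi_minus_le s t m Hm Hs Ht) as Hd.
  pose proof (Cmod_ge_0 (expi (- s) - expi (- t))).
  pose proof (Rabs_pos V2). pose proof (Rabs_pos V3).
  pose proof (Rabs_pos (k - 1)).
  rewrite Rmult_1_l, Rmult_1_r.
  replace (((1 + / m) * Rabs (cos t - cos s) + 6 * Rabs (k - 1)) * / m * Y)
    with ((1 + / m) * Rabs (cos t - cos s) * (Y / m)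
          + Rabs (k - 1) * (6 * (Y / m))) by (unfold Rdiv; ring).
  apply Rplus_le_compat.
  - apply Rmult_le_compat; auto.
  - apply Rmult_le_compat_l; auto.
Qed.

(** * Solutions of the Jacobi equation *)

Definition real_solution (am1 : R) (a b : nat -> R) (lam : R) (u : nat -> R) :=
  forall n : nat,
    aprev am1 a n * u n + b n * u (S n) + a n * u (S (S n)) = lam * u (S n).

Fixpoint sol (am1 : R) (a b : nat -> R) (lam u0 u1 : R) (k : nat) : R :=
  match k with
  | O => u0
  | S m =>
      match m with
      | O => u1
      | S n => ((lam - b n) * sol am1 a b lam u0 u1 m
                - aprev am1 a n * sol am1 a b lam u0 u1 n) / a n
      end
  end.

Lemma sol_SS (am1 : R) (a b : nat -> R) (lam u0 u1 : R) (n : nat) :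
  sol am1 a b lam u0 u1 (S (S n))
  = ((lam - b n) * sol am1 a b lam u0 u1 (S n)
     - aprev am1 a n * sol am1 a b lam u0 u1 n) / a n.
Proof. reflexivity. Qed.

Lemma sol_solution (am1 : R) (a b : nat -> R) (lam u0 u1 : R) :
  (forall n, 0 < a n) -> real_solution am1 a b lam (sol am1 a b lam u0 u1).
Proof.
  intros Ha n. rewrite sol_SS. field. specialize (Ha n). lra.
Qed.

Lemma real_solution_jacobi (am1 : R) (a b : nat -> R) (lam : R) (u : nat -> R) :
  real_solution am1 a b lam u ->
  jacobi_solution am1 a b (RtoC lam) (fun k => RtoC (u k)).
Proof.
  intros H n. now rewrite <- !RtoC_mult, <- !RtoC_plus, H.
Qed.

Lemma Psol_real (am1 : R) (a b : nat -> R) (lam : R) (k : nat) :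
  (forall n, 0 < a n) ->
  Psol am1 a b (RtoC lam) k = RtoC (sol am1 a b lam 0 1 k).
Proof.
  intros Ha.
  assert (H : Psol am1 a b lam k = sol am1 a b lam 0 1 k
              /\ Psol am1 a b lam (S k) = sol am1 a b lam 0 1 (S k));
    [|apply H].
  induction k as [|k [IH1 IH2]]; [split; reflexivity|].
  split; [exact IH2|].
  rewrite sol_SS, RtoC_div, RtoC_minus, !RtoC_mult, RtoC_minus, <- IH1, <- IH2;
    [reflexivity | specialize (Ha k); lra].
Qed.

(** Provides a starting value for the Gronwall estimate that is bounded uniformly in [lam]. The
    induction carries two consecutive indices, as the recurrence has order two. *)
Lemma sol_bounded (am1 : R) (a b : nat -> R) (u0 u1 rho : R) (k : nat) :
  exists B, forall lam, Rabs lam < rho -> Rabs (sol am1 a b lam u0 u1 k) <= B.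
Proof.
  assert (H : exists B, forall lam, Rabs lam < rho ->
    Rabs (sol am1 a b lam u0 u1 k) <= B /\ Rabs (sol am1 a b lam u0 u1 (S k)) <= B).
  { induction k as [|k [B IH]].
    - exists (Rmax (Rabs u0) (Rabs u1)). intros lam _.
      split; [apply Rmax_l | apply Rmax_r].
    - exists (Rmax B (((rho + Rabs (b k)) * B + Rabs (aprev am1 a k) * B)
                      * Rabs (/ a k))).
      intros lam Hl. destruct (IH lam Hl) as [I1 I2].
      split; [eapply Rle_trans; [exact I2 | apply Rmax_l]|].
      eapply Rle_trans; [|apply Rmax_r].
      rewrite sol_SS. unfold Rdiv. rewrite Rabs_mult.
      apply Rmult_le_compat_r; [apply Rabs_pos|].
      unfold Rminus at 1. eapply Rle_trans; [apply Rabs_triang|].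
      rewrite Rabs_Ropp, !Rabs_mult.
      apply Rplus_le_compat.
      + apply Rmult_le_compat; try apply Rabs_pos; [|exact I2].
        eapply Rle_trans; [apply Rabs_triang|]. rewrite Rabs_Ropp. lra.
      + apply Rmult_le_compat_l; [apply Rabs_pos | exact I1]. }
  destruct H as [B H]. exists B. intros lam Hl. now apply H.
Qed.

Lemma wronskian_const (am1 : R) (a b : nat -> R) (z : C) (u v : nat -> C) (k : nat) :
  jacobi_solution am1 a b z u -> jacobi_solution am1 a b z v ->
  wronskian am1 a k u v = wronskian am1 a 0 u v.
Proof.
  intros Hu Hv. induction k as [|k IH]; [reflexivity|].
  rewrite <- IH. unfold wronskian.
  change (aprev am1 a (S k)) with (a k).
  specialize (Hu k). specialize (Hv k).
  transitivity (u (S k) * (a k * v (S (S k))) - (a k * u (S (S k))) * v (S k))%C;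
    [ring|].
  replace (a k * u (S (S k)))%C
    with (z * u (S k) - aprev am1 a k * u k - b k * u (S k))%C
    by (rewrite <- Hu; ring).
  replace (a k * v (S (S k)))%C
    with (z * v (S k) - aprev am1 a k * v k - b k * v (S k))%C
    by (rewrite <- Hv; ring).
  ring.
Qed.

(** * Rescaled solutions and the ratio of consecutive coefficients *)

(** With the index shift of solutions, [scaled am1 a u (S n)] is [v_n = sqrt(a_n) u_n]. *)
Definition scaled (am1 : R) (a : nat -> R) (u : nat -> R) (k : nat) : R :=
  sqrt (aprev am1 a k) * u k.

(** The factor [sqrt(a_{k-1} / a_k)] by which the Wronskian differs from the determinant of the
    rescaled solutions. *)
Definition ratio (am1 : R) (a : nat -> R) (k : nat) : R :=
  sqrt (aprev am1 a k) / sqrt (a k).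

Lemma aprev_pos (am1 : R) (a : nat -> R) (k : nat) :
  0 < am1 -> (forall n, 0 < a n) -> 0 < aprev am1 a k.
Proof. intros H1 H. destruct k; simpl; auto. Qed.

Lemma scaled_recurrence (am1 : R) (a b : nat -> R) (lam : R) (u : nat -> R) (n : nat) :
  0 < am1 -> (forall n, 0 < a n) ->
  real_solution am1 a b lam u ->
  scaled am1 a u n + kcoef am1 a n * scaled am1 a u (S (S n))
  = 2 * (alpha am1 a n * lam + beta am1 a b n) * scaled am1 a u (S n).
Proof.
  intros H1 Ha Hu. specialize (Hu n).
  unfold scaled, kcoef, alpha, beta.
  change (aprev am1 a (S (S n))) with (a (S n)).
  change (aprev am1 a (S n)) with (a n).
  pose proof (aprev_pos am1 a n H1 Ha) as Hp.
  pose proof (Ha n) as Hr. pose proof (Ha (S n)) as Ht.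
  rewrite !sqrt_mult by lra.
  pose proof (sqrt_lt_R0 _ Hp) as Hp'. pose proof (sqrt_lt_R0 _ Hr) as Hr'.
  pose proof (sqrt_lt_R0 _ Ht) as Ht'.
  pose proof (sqrt_sqrt _ (Rlt_le _ _ Hp)) as Ep.
  pose proof (sqrt_sqrt _ (Rlt_le _ _ Hr)) as Er.
  set (p := sqrt (aprev am1 a n)) in *. set (r := sqrt (a n)) in *.
  set (t := sqrt (a (S n))) in *.
  transitivity ((lam - b n) * u (S n) / p); [|field; lra].
  replace ((lam - b n) * u (S n)) with (p * p * u n + a n * u (S (S n)))
    by (rewrite Ep; lra).
  field. lra.
Qed.

Lemma wronskian_scaled (am1 : R) (a : nat -> R) (u v : nat -> R) (k : nat) :
  0 < am1 -> (forall n, 0 < a n) ->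
  wronskian am1 a k (fun k => RtoC (u k)) (fun k => RtoC (v k))
  = RtoC (ratio am1 a k
          * (scaled am1 a u k * scaled am1 a v (S k)
             - scaled am1 a u (S k) * scaled am1 a v k)).
Proof.
  intros H1 Ha. unfold wronskian, ratio, scaled.
  rewrite <- !RtoC_mult, <- RtoC_minus, <- RtoC_mult. f_equal.
  change (aprev am1 a (S k)) with (a k).
  pose proof (aprev_pos am1 a k H1 Ha) as Hp.
  rewrite <- (sqrt_sqrt (aprev am1 a k)) at 1 by lra.
  field. apply Rgt_not_eq, sqrt_lt_R0, Ha.
Qed.

Lemma ratio_pos (am1 : R) (a : nat -> R) (k : nat) :
  0 < am1 -> (forall n, 0 < a n) -> 0 < ratio am1 a k.
Proof.
  intros H1 Ha. apply Rdiv_lt_0_compat; apply sqrt_lt_R0; auto using aprev_pos.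
Qed.

(** [kcoef] is the quotient of consecutive ratios, so summability of [k_n - 1] forces the ratios to
    converge. *)
Lemma ratio_S (am1 : R) (a : nat -> R) (k : nat) :
  0 < am1 -> (forall n, 0 < a n) ->
  ratio am1 a (S k) = kcoef am1 a k * ratio am1 a k.
Proof.
  intros H1 Ha. unfold ratio, kcoef.
  change (aprev am1 a (S k)) with (a k).
  pose proof (aprev_pos am1 a k H1 Ha) as Hp.
  pose proof (Ha k) as Hr. pose proof (Ha (S k)) as Ht.
  rewrite sqrt_mult by lra.
  pose proof (sqrt_lt_R0 _ Hp). pose proof (sqrt_lt_R0 _ Hr).
  pose proof (sqrt_lt_R0 _ Ht).
  rewrite <- (sqrt_sqrt (a k)) at 2 by lra.
  field. lra.
Qed.

(** A limit below 1 would make [a_n] grow geometrically, contradicting the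
    divergence of the sum of [1 / a_n]; a limit above 1 would make it decrease. *)
Lemma ratio_lim (am1 : R) (a : nat -> R) :
  0 < am1 -> (forall n, 0 < a n) ->
  is_lim_seq a p_infty ->
  ex_series (fun n => Rabs (kcoef am1 a n - 1)) ->
  is_lim_seq (sum_n (fun n => / a n)) p_infty ->
  is_lim_seq (ratio am1 a) 1.
Proof.
  intros H1 Ha Hainf Hk Hcar.
  destruct (summable_primitive _ Hk) as (E & L & HE & HL).
  assert (Hinc : forall n, E n <= E (S n)).
  { intros n. specialize (HE n). pose proof (Rabs_pos (kcoef am1 a n - 1)). lra. }
  (* By [ratio_S] the increment of the ratio is [(k_n - 1)] times the ratio itself, which is the
     Gronwall form. *)
  destruct (discrete_gronwall (fun n => RtoC (ratio am1 a n)) E L 0 Hinc HL)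
    as [l Hl].
  { intros n _. rewrite <- RtoC_minus, !Cmod_R, ratio_S, HE, <- Rabs_mult by auto.
    apply Req_le. f_equal. ring. }
  assert (Hlim : is_lim_seq (ratio am1 a) (Re l)).
  { apply (is_lim_seq_ext (fun n => (ratio am1 a n - Re l) + Re l)); [intro; ring|].
    replace (Finite (Re l)) with (Finite (0 + Re l)) by (f_equal; ring).
    apply is_lim_seq_plus'; [|apply is_lim_seq_const].
    apply (is_lim_seq_dominated _
      (fun n => Cmod (RtoC (ratio am1 a 0)) * exp (L - E 0%nat) * 2 * (L - E n))).
    - exists 0%nat. intros n Hn. specialize (Hl n Hn).
      eapply Rle_trans; [|eapply Rle_trans; [exact Hl | apply Req_le; ring]].
      eapply Rle_trans; [|apply re_le_Cmod]. apply Req_le. reflexivity.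
    - match goal with |- is_lim_seq (fun n => ?c * _) _ =>
        replace (Finite 0) with (Finite (c * (L - L))) by (f_equal; ring);
        apply (is_lim_seq_scal_l (fun n => L - E n) c (L - L)) end.
      apply is_lim_seq_minus'; [apply is_lim_seq_const | exact HL]. }
  (* Together with [Re l < 1] this gives [Re l * Re l < 1], the limit of [a_n / a_{n+1}] in the
     d'Alembert test below. *)
  assert (Hge : 0 <= Re l).
  { apply (is_lim_seq_le (fun _ => 0) (ratio am1 a) 0 (Re l));
      [intro; apply Rlt_le, ratio_pos; auto | apply is_lim_seq_const | exact Hlim]. }
  destruct (Rtotal_order (Re l) 1) as [Hlt | [Heq | Hgt]];
    [exfalso | now rewrite Heq in Hlim | exfalso].
  - assert (Hs : ex_series (fun n => Rabs (/ a n))).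
    { apply (ex_series_DAlembert _ (Re l * Re l)); [nra | |].
      - intros n. apply Rinv_neq_0_compat. specialize (Ha n). lra.
      - apply (is_lim_seq_ext (fun n => ratio am1 a (S n) * ratio am1 a (S n))).
        + intros n. unfold ratio. change (aprev am1 a (S n)) with (a n).
          pose proof (Ha n). pose proof (Ha (S n)).
          pose proof (sqrt_lt_R0 _ (Ha (S n))).
          transitivity (sqrt (a n) * sqrt (a n) / (sqrt (a (S n)) * sqrt (a (S n))));
            [field; lra|].
          rewrite !sqrt_sqrt by lra.
          replace (/ a (S n) / / a n) with (a n / a (S n)) by (field; lra).
          rewrite Rabs_pos_eq; [reflexivity | apply Rlt_le, Rdiv_lt_0_compat; lra].
        + apply (is_lim_seq_mult' _ _ (Re l) (Re l));
            apply -> is_lim_seq_incr_1; exact Hlim. }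
    apply ex_series_Rabs in Hs. apply Series_correct in Hs.
    change (is_lim_seq (sum_n (fun n => / a n)) (Series (fun n => / a n))) in Hs.
    pose proof (is_lim_seq_unique _ _ Hs) as U1.
    rewrite (is_lim_seq_unique _ _ Hcar) in U1. discriminate U1.
  - apply is_lim_seq_spec in Hlim. simpl in Hlim.
    destruct (Hlim (mkposreal _ (proj2 (Rlt_0_minus _ _) Hgt))) as [N HN]. simpl in HN.
    assert (Hdec : forall n, (N <= n)%nat -> a (S n) <= a n).
    { intros n Hn. specialize (HN (S n) ltac:(lia)).
      apply Rabs_lt_between in HN.
      assert (Hr : 1 < ratio am1 a (S n)) by lra.
      unfold ratio in Hr. change (aprev am1 a (S n)) with (a n) in Hr.
      pose proof (sqrt_lt_R0 _ (Ha (S n))) as Hs.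
      apply (Rmult_lt_compat_r _ _ _ Hs) in Hr.
      unfold Rdiv in Hr. rewrite Rmult_assoc, Rinv_l, Rmult_1_l, Rmult_1_r in Hr by lra.
      apply sqrt_lt_0_alt in Hr. lra. }
    assert (Hle : forall j, a (N + j)%nat <= a N).
    { induction j as [|j IH]; [rewrite Nat.add_0_r; lra|].
      rewrite Nat.add_succ_r. specialize (Hdec (N + j)%nat ltac:(lia)). lra. }
    apply is_lim_seq_spec in Hainf. destruct (Hainf (a N)) as [M HM].
    specialize (HM (N + M)%nat ltac:(lia)). specialize (Hle M). lra.
Qed.

(** * Differences annihilating the Jost asymptotics *)

Definition theta (am1 : R) (a b : nat -> R) (n : nat) (lam : R) : R :=
  acos (alpha am1 a n * lam + beta am1 a b n).

Lemma fold_right_Rplus_init (l : list R) (x : R) :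
  fold_right Rplus x l = fold_right Rplus 0 l + x.
Proof. induction l as [|y l IH]; simpl; [|rewrite IH]; ring. Qed.

Lemma phi_S (am1 : R) (a b : nat -> R) (N0 n : nat) (lam : R) :
  (N0 <= n)%nat ->
  phi am1 a b N0 (S n) lam = phi am1 a b N0 n lam + theta am1 a b n lam.
Proof.
  intros Hn. unfold phi.
  replace (S n - N0)%nat with (S (n - N0)) by lia.
  rewrite seq_S, map_app, fold_right_app. simpl.
  rewrite fold_right_Rplus_init. replace (N0 + (n - N0))%nat with n by lia.
  unfold theta. ring.
Qed.

(** On the edges the root at [cos theta] is [i sin theta] times the sign of the side, so [zeta]
    takes the value [cos theta] minus that number. *)
Lemma zetan_expi (am1 : R) (a b : nat -> R) (n : nat) (s : side) (lam : R) :
  -1 < alpha am1 a n * lam + beta am1 a b n < 1 ->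
  zetan am1 a b n s (RtoC lam) = expi (- (side_sign s * theta am1 a b n lam)).
Proof.
  intros Hx. unfold zetan, zeta, theta. rewrite <- RtoC_mult, <- RtoC_plus.
  set (x := alpha am1 a n * lam + beta am1 a b n) in *.
  rewrite sqrt_z2m1_edge by exact Hx.
  replace (1 - x ^ 2) with (1 - Rsqr x) by (unfold Rsqr; ring).
  rewrite <- sin_acos by lra.
  assert (Hc := cos_acos x ltac:(lra)).
  unfold expi; rewrite cos_neg, sin_neg.
  destruct s; unfold side_sign.
  - rewrite !Rmult_1_l, Hc. apply injective_projections; simpl; ring.
  - replace (-1 * acos x) with (- acos x) by ring.
    rewrite cos_neg, sin_neg, Hc. apply injective_projections; simpl; ring.
Qed.

Lemma q_expi (am1 : R) (a b : nat -> R) (N0 n : nat) (s : side) (lam : R) :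
  (forall k, (N0 <= k)%nat -> -1 < alpha am1 a k * lam + beta am1 a b k < 1) ->
  q am1 a b N0 n s (RtoC lam) = expi (- (side_sign s * phi am1 a b N0 n lam)).
Proof.
  intros Hx. unfold q, phi.
  assert (Hl : forall k, In k (seq N0 (n - N0)) -> (N0 <= k)%nat)
    by (intros k Hk; apply in_seq in Hk; lia).
  induction (seq N0 (n - N0)) as [|k l IH]; simpl.
  - rewrite Rmult_0_r, Ropp_0. unfold expi. rewrite cos_0, sin_0. reflexivity.
  - rewrite IH by (intros; apply Hl; simpl; auto).
    rewrite zetan_expi by (apply Hx, Hl; simpl; auto).
    rewrite <- expi_add. f_equal. unfold theta. ring.
Qed.

(** If [scaled u] is asymptotic to a combination of [q_n] and its conjugate, the
    difference kills the [q_n]-part and the factor [q_n] makes the other part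
    constant. *)
Definition amplitude (am1 : R) (a b : nat -> R) (N0 : nat) (s : side) (lam : R)
    (u : nat -> R) (n : nat) : C :=
  (expi (- (side_sign s * phi am1 a b N0 n lam))
   * (scaled am1 a u (S (S n))
      - expi (- (side_sign s * theta am1 a b n lam)) * scaled am1 a u (S n)))%C.

(** For real [u] the two edges differ by conjugation, so estimates on the upper edge suffice. *)
Lemma amplitude_conj (am1 : R) (a b : nat -> R) (N0 : nat) (lam : R)
    (u : nat -> R) (n : nat) :
  amplitude am1 a b N0 Lower lam u n = Cconj (amplitude am1 a b N0 Upper lam u n).
Proof.
  unfold amplitude, side_sign.
  rewrite Cmult_conj, expi_conj, Cminus_conj, Cmult_conj, expi_conj.
  unfold Cconj at 1 2; simpl.
  replace (- (-1 * phi am1 a b N0 n lam)) with (- - (1 * phi am1 a b N0 n lam)) by ring.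
  replace (- (-1 * theta am1 a b n lam)) with (- - (1 * theta am1 a b n lam)) by ring.
  unfold RtoC. rewrite Ropp_0. reflexivity.
Qed.

(** The [theta] terms cancel, leaving [q_n] times a determinant which the constant Wronskian
    evaluates. This is the source of the Jost asymptotics. *)
Lemma amplitude_cross (am1 : R) (a b : nat -> R) (N0 : nat) (s : side) (lam : R)
    (u v : nat -> R) (n : nat) :
  (amplitude am1 a b N0 s lam u n * scaled am1 a v (S n)
   - amplitude am1 a b N0 s lam v n * scaled am1 a u (S n)
   = expi (- (side_sign s * phi am1 a b N0 n lam))
     * RtoC (scaled am1 a u (S (S n)) * scaled am1 a v (S n)
             - scaled am1 a v (S (S n)) * scaled am1 a u (S n)))%C.
Proof. unfold amplitude. rewrite RtoC_minus, !RtoC_mult. ring. Qed.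

Lemma scaled_le_amplitude (am1 : R) (a b : nat -> R) (N0 : nat) (s : side)
    (lam : R) (u : nat -> R) (n : nat) (m : R) :
  0 < m -> m <= sin (theta am1 a b n lam) ->
  Rabs (scaled am1 a u (S n)) <= Cmod (amplitude am1 a b N0 s lam u n) / m.
Proof.
  intros Hm Hs. apply (Rabs_le_of_mult _ _ _ _ Hm Hs).
  unfold amplitude. rewrite Cmod_mult, expi_mod, Rmult_1_l.
  eapply Rle_trans; [|apply Rabs_mul_sin_le_l].
  rewrite !Rabs_mult. apply Req_le. f_equal.
  destruct s; unfold side_sign; [now rewrite Rmult_1_l|].
  replace (-1 * theta am1 a b n lam) with (- theta am1 a b n lam) by ring.
  now rewrite sin_neg, Rabs_Ropp.
Qed.

Lemma scaled_eq_amplitude (am1 : R) (a b : nat -> R) (N0 : nat)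
    (lam : R) (u : nat -> R) (n : nat) :
  scaled am1 a u (S n) * sin (theta am1 a b n lam)
  = Im (expi (phi am1 a b N0 n lam) * amplitude am1 a b N0 Upper lam u n).
Proof.
  unfold amplitude, side_sign. rewrite Cmult_assoc, !Rmult_1_l, expi_mul_opp.
  unfold expi; simpl. rewrite sin_neg. ring.
Qed.

Lemma scaled_eventually_bounded (am1 : R) (a b : nat -> R) (N0 : nat) (s : side)
    (lam : R) (u : nat -> R) (m : R) (h : C) :
  0 < m -> (forall n, (N0 <= n)%nat -> m <= sin (theta am1 a b n lam)) ->
  is_lim_seq (fun n => Cmod (amplitude am1 a b N0 s lam u n - h)) 0 ->
  eventually (fun n => Rabs (scaled am1 a u (S n)) <= (Cmod h + 1) / m).
Proof.
  intros Hm Hs Hh. apply is_lim_seq_spec in Hh.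
  destruct (Hh (mkposreal 1 Rlt_0_1)) as [N HN]. simpl in HN.
  exists (N + N0)%nat. intros n Hn. specialize (HN n ltac:(lia)).
  eapply Rle_trans; [apply (scaled_le_amplitude _ _ b N0 s lam _ _ m Hm), Hs; lia|].
  apply Rmult_le_compat_r; [now apply Rlt_le, Rinv_0_lt_compat|].
  rewrite Rminus_0_r, Rabs_pos_eq in HN by apply Cmod_ge_0.
  replace (amplitude am1 a b N0 s lam u n)
    with (h + (amplitude am1 a b N0 s lam u n - h))%C by ring.
  eapply Rle_trans; [apply Cmod_triangle|]. lra.
Qed.

Lemma lim_bounded_mult (u v : nat -> R) (B : R) :
  is_lim_seq u 0 -> eventually (fun n => Rabs (v n) <= B) ->
  is_lim_seq (fun n => u n * v n) 0.
Proof.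
  intros Hu [N HN]. apply (is_lim_seq_dominated _ (fun n => B * Rabs (u n))).
  - exists N. intros n Hn. rewrite Rabs_mult, Rmult_comm.
    apply Rmult_le_compat_r; [apply Rabs_pos | auto].
  - replace (Finite 0) with (Rbar_mult B 0) by (simpl; f_equal; ring).
    apply is_lim_seq_scal_l. now apply is_lim_seq_abs_0 in Hu.
Qed.

Lemma Cmult_eq_0_reg_l (x y : C) : x <> 0 -> (x * y = 0)%C -> y = 0.
Proof.
  intros Hx H. transitivity (/ x * (x * y))%C; [now field|]. rewrite H. ring.
Qed.

(** * Existence and uniqueness of the Jost solution, and the value of [Omega] *)

Section OmegaLimit.

Context (am1 : R) (a b : nat -> R) (N0 : nat) (lam m : R).
Context (am1_pos : 0 < am1) (a_pos : forall n, 0 < a n).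
Context (ratio_to_1 : is_lim_seq (ratio am1 a) 1).
Context (x_bound : forall n, (N0 <= n)%nat ->
           -1 < alpha am1 a n * lam + beta am1 a b n < 1).
Context (m_pos : 0 < m).
Context (sin_bound : forall n, (N0 <= n)%nat -> m <= sin (theta am1 a b n lam)).

Lemma ratio_inv_lim : is_lim_seq (fun n => / ratio am1 a (S n) - 1) 0.
Proof.
  replace (Finite 0) with (Finite (/ 1 - 1)) by (f_equal; field).
  apply is_lim_seq_minus'; [|apply is_lim_seq_const].
  apply (is_lim_seq_inv (fun n => ratio am1 a (S n)) 1).
  - now apply -> is_lim_seq_incr_1.
  - intros H. injection H. lra.
Qed.

(** Applied to the difference [d] of two Jost solutions, this gives uniqueness. *)
Lemma wronskian_decay (s : side) (u : nat -> R) (h : C) (d r : nat -> C) :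
  real_solution am1 a b lam u ->
  is_lim_seq (fun n => Cmod (amplitude am1 a b N0 s lam u n - h)) 0 ->
  jacobi_solution am1 a b (RtoC lam) d ->
  is_lim_seq (fun n => Cmod (r n)) 0 ->
  eventually (fun n => d (S n) = / sqrt (a n) * r n)%C ->
  wronskian am1 a 0 (fun k => RtoC (u k)) d = 0.
Proof.
  intros Hu Hh Hd Hr Hdr.
  pose proof (scaled_eventually_bounded am1 a b N0 s lam u m h m_pos sin_bound Hh) as HB.
  apply Cmod_eq_0.
  (* The Wronskian at index 0 equals the one at every index [S n], which is a bounded factor times
     terms tending to 0; a constant with limit 0 is 0. *)
  assert (Hlim : is_lim_seq (fun _ : nat => Cmod (wronskian am1 a 0 (fun k => RtoC (u k)) d)) 0).
  2:{ pose proof (is_lim_seq_unique _ _ Hlim) as E. rewrite Lim_seq_const in E.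
      now injection E. }
  apply (is_lim_seq_dominated _ (fun n =>
    Rabs (ratio am1 a (S n))
    * (Cmod (r (S n)) * Rabs (scaled am1 a u (S n))
       + Cmod (r n) * Rabs (scaled am1 a u (S (S n)))))).
  - destruct Hdr as [N HN]. exists N. intros n Hn.
    rewrite Rabs_pos_eq by apply Cmod_ge_0.
    rewrite <- (wronskian_const am1 a b lam _ d (S n)
                  (real_solution_jacobi _ _ _ _ _ Hu) Hd).
    unfold wronskian. rewrite (HN n), (HN (S n)) by lia.
    assert (E : (aprev am1 a (S n)
        * (u (S n) * (/ sqrt (a (S n)) * r (S n))
           - u (S (S n)) * (/ sqrt (a n) * r n))
        = ratio am1 a (S n) * (r (S n) * scaled am1 a u (S n)
                               - r n * scaled am1 a u (S (S n))))%C).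
    { unfold ratio, scaled. change (aprev am1 a (S n)) with (a n).
      change (aprev am1 a (S (S n))) with (a (S n)).
      pose proof (sqrt_lt_R0 _ (a_pos n)). pose proof (sqrt_lt_R0 _ (a_pos (S n))).
      rewrite <- (sqrt_sqrt (a n)) at 1 by (apply Rlt_le, a_pos).
      rewrite RtoC_div, !RtoC_mult by lra. field.
      split; intro Hz; apply RtoC_inj in Hz; lra. }
    rewrite E, Cmod_mult, Cmod_R. apply Rmult_le_compat_l; [apply Rabs_pos|].
    eapply Rle_trans; [apply Cmod_triangle|].
    rewrite Cmod_opp, !Cmod_mult, !Cmod_R. lra.
  - replace (Finite 0) with (Finite (Rabs 1 * (0 + 0)))
      by (f_equal; ring).
    apply is_lim_seq_mult'.
    { apply (is_lim_seq_abs _ 1). now apply -> is_lim_seq_incr_1. }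
    destruct HB as [N HN].
    apply is_lim_seq_plus';
      (apply (lim_bounded_mult _ _ ((Cmod h + 1) / m));
       [| exists N; intros n Hn; rewrite Rabs_Rabsolu; apply HN; lia]).
    + now apply -> (is_lim_seq_incr_1 (fun n => Cmod (r n))).
    + exact Hr.
Qed.

(** [jost] is a choice among unique solutions, so its value is known only once an explicit candidate
    has been shown both to satisfy [is_jost] and to be the only such solution. *)
Lemma Omega_limit (s : side) (h1 h2 : C) :
  is_lim_seq (fun n =>
    Cmod (amplitude am1 a b N0 s lam (sol am1 a b lam 0 1) n - h1)) 0 ->
  is_lim_seq (fun n =>
    Cmod (amplitude am1 a b N0 s lam (sol am1 a b lam 1 0) n - h2)) 0 ->
  Omega am1 a b N0 s (RtoC lam) = (- h1)%C.
Proof.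
  set (u := sol am1 a b lam 0 1). set (v := sol am1 a b lam 1 0).
  intros Hh1 Hh2.
  assert (Hu : real_solution am1 a b lam u) by now apply sol_solution.
  assert (Hv : real_solution am1 a b lam v) by now apply sol_solution.
  assert (am1_neq : RtoC am1 <> 0) by (intro Hz; apply RtoC_inj in Hz; lra).
  (* The initial data [(0, 1)] and [(1, 0)] make the Wronskian of [u] and [v] equal to [- am1]. *)
  assert (Hw : forall n,
    scaled am1 a u (S (S n)) * scaled am1 a v (S n)
    - scaled am1 a v (S (S n)) * scaled am1 a u (S n) = am1 / ratio am1 a (S n)).
  { intros n.
    pose proof (wronskian_const am1 a b lam _ _ (S n)
      (real_solution_jacobi _ _ _ _ _ Hu) (real_solution_jacobi _ _ _ _ _ Hv)) as E.
    rewrite wronskian_scaled in E by assumption.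
    replace (wronskian am1 a 0 _ _) with (RtoC (- am1)) in E
      by (unfold wronskian, u, v; simpl; rewrite RtoC_opp; ring).
    apply RtoC_inj in E.
    pose proof (ratio_pos am1 a (S n) am1_pos a_pos).
    apply (Rmult_eq_reg_l (ratio am1 a (S n))); [|lra].
    replace (ratio am1 a (S n) * (am1 / ratio am1 a (S n))) with am1 by (field; lra).
    lra. }
  set (f := fun k => ((h1 * v k - h2 * u k) / am1)%C).
  assert (Hf : jacobi_solution am1 a b lam f).
  { intros n. unfold f.
    pose proof (real_solution_jacobi _ _ _ _ _ Hu n) as E1.
    pose proof (real_solution_jacobi _ _ _ _ _ Hv n) as E2. simpl in E1, E2.
    transitivity ((h1 * (aprev am1 a n * v n + b n * v (S n) + a n * v (S (S n)))
      - h2 * (aprev am1 a n * u n + b n * u (S n) + a n * u (S (S n)))) / am1)%C;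
      [now field|].
    rewrite E1, E2. now field. }
  assert (Hq : forall n, q am1 a b N0 n s lam
                         = expi (- (side_sign s * phi am1 a b N0 n lam)))
    by (intro; now apply q_expi).
  assert (Hjf : is_jost am1 a b N0 s lam f).
  { split; [exact Hf|].
    exists (fun n => (/ q am1 a b N0 n s lam * (sqrt (a n) * f (S n)) - 1)%C). split.
    - apply (is_lim_seq_dominated _ (fun n =>
        Rabs (/ ratio am1 a (S n) - 1)
        + / am1 * (Cmod (amplitude am1 a b N0 s lam u n - h1) * Rabs (scaled am1 a v (S n))
           + Cmod (amplitude am1 a b N0 s lam v n - h2) * Rabs (scaled am1 a u (S n))))).
      + exists 0%nat. intros n _. rewrite Rabs_pos_eq by apply Cmod_ge_0.
        rewrite Hq. set (e := expi _).
        assert (He : Cmod e = 1) by apply expi_mod.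
        assert (He0 : e <> 0) by (apply Cmod_gt_0; lra).
        (* Replacing [h1] and [h2] in [f] by the amplitudes would give exactly [e / ratio] through
           [amplitude_cross]; what remains is the error of this replacement. *)
        assert (E : (/ e * (sqrt (a n) * f (S n)) - 1
          = RtoC (/ ratio am1 a (S n) - 1)
            + / e * (/ am1
              * ((amplitude am1 a b N0 s lam v n - h2) * scaled am1 a u (S n)
                 - (amplitude am1 a b N0 s lam u n - h1) * scaled am1 a v (S n))))%C).
        { pose proof (amplitude_cross am1 a b N0 s lam u v n) as Hc. fold e in Hc.
          rewrite Hw in Hc.
          pose proof (ratio_pos am1 a (S n) am1_pos a_pos) as Hrp.
          assert (HrC : RtoC (ratio am1 a (S n)) <> 0)
            by (intro Hz; apply RtoC_inj in Hz; lra).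
          rewrite RtoC_div in Hc by lra.
          transitivity ((h1 * scaled am1 a v (S n) - h2 * scaled am1 a u (S n))
                        / (am1 * e) - 1)%C.
          { unfold f, scaled. change (aprev am1 a (S n)) with (a n).
            rewrite !RtoC_mult. field. auto. }
          rewrite RtoC_minus, RtoC_inv by lra.
          transitivity (1 / ratio am1 a (S n) - 1
            + ((h1 * scaled am1 a v (S n) - h2 * scaled am1 a u (S n))
               - (e * (am1 / ratio am1 a (S n)))) / (am1 * e))%C; [field; auto|].
          rewrite <- Hc. field. auto. }
        rewrite E. eapply Rle_trans; [apply Cmod_triangle|].
        rewrite Cmod_R. apply Rplus_le_compat_l.
        rewrite Cmod_mult, Cmod_inv, He, Rinv_1, Rmult_1_l by exact He0.
        rewrite Cmod_mult, Cmod_inv, Cmod_R, Rabs_pos_eq by (auto; lra).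
        apply Rmult_le_compat_l; [now apply Rlt_le, Rinv_0_lt_compat|].
        eapply Rle_trans; [apply Cmod_triangle|].
        rewrite Cmod_opp, !Cmod_mult, !Cmod_R. lra.
      + replace (Finite 0) with (Finite (0 + / am1 * (0 + 0))) by (f_equal; ring).
        apply is_lim_seq_plus';
          [apply (is_lim_seq_abs_0 (fun n => / ratio am1 a (S n) - 1)), ratio_inv_lim|].
        apply is_lim_seq_mult'; [apply is_lim_seq_const|].
        apply is_lim_seq_plus'.
        * apply (lim_bounded_mult _ _ ((Cmod h2 + 1) / m) Hh1).
          destruct (scaled_eventually_bounded _ _ _ _ _ _ _ _ _ m_pos sin_bound Hh2) as [N HN].
          exists N. intros n Hn. rewrite Rabs_Rabsolu. auto.
        * apply (lim_bounded_mult _ _ ((Cmod h1 + 1) / m) Hh2).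
          destruct (scaled_eventually_bounded _ _ _ _ _ _ _ _ _ m_pos sin_bound Hh1) as [N HN].
          exists N. intros n Hn. rewrite Rabs_Rabsolu. auto.
    - exists 0%nat. intros n _. rewrite Hq.
      pose proof (expi_mod (- (side_sign s * phi am1 a b N0 n lam))) as He.
      set (e := expi _) in *.
      assert (He0 : e <> 0) by (apply Cmod_gt_0; lra).
      pose proof (sqrt_lt_R0 _ (a_pos n)).
      field. split; [exact He0|]. intro Hz; apply RtoC_inj in Hz; lra. }
  assert (Huniq : forall g, is_jost am1 a b N0 s lam g -> f = g).
  { intros g [Hg [r2 [Hr2 [N2 E2]]]]. destruct Hjf as [_ [r1 [Hr1 [N1 E1]]]].
    set (d := fun k => (f k - g k)%C).
    assert (Hd : jacobi_solution am1 a b lam d).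
    { intros n. unfold d. specialize (Hf n). specialize (Hg n).
      transitivity ((aprev am1 a n * f n + b n * f (S n) + a n * f (S (S n)))
        - (aprev am1 a n * g n + b n * g (S n) + a n * g (S (S n))))%C; [ring|].
      rewrite Hf, Hg. ring. }
    set (r := fun n => (q am1 a b N0 n s lam * (r1 n - r2 n))%C).
    assert (Hr : is_lim_seq (fun n => Cmod (r n)) 0).
    { apply (is_lim_seq_dominated _ (fun n => Cmod (r1 n) + Cmod (r2 n))).
      - exists 0%nat. intros n _. rewrite Rabs_pos_eq by apply Cmod_ge_0.
        unfold r. rewrite Cmod_mult, Hq, expi_mod, Rmult_1_l.
        eapply Rle_trans; [apply Cmod_triangle|]. rewrite Cmod_opp. lra.
      - replace (Finite 0) with (Finite (0 + 0)) by (f_equal; ring).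
        now apply is_lim_seq_plus'. }
    assert (Hdr : eventually (fun n => d (S n) = / sqrt (a n) * r n)%C).
    { exists (N1 + N2)%nat. intros n Hn. unfold d, r.
      rewrite E1, E2 by lia. ring. }
    pose proof (wronskian_decay s u h1 d r Hu Hh1 Hd Hr Hdr) as W1.
    pose proof (wronskian_decay s v h2 d r Hv Hh2 Hd Hr Hdr) as W2.
    unfold wronskian in W1, W2; simpl in W1, W2.
    (* Because of their initial data, the Wronskian with [u] sees only [d 0] and the one with [v]
       only [d 1]. Two vanishing consecutive values then propagate by the recurrence. *)
    assert (D0 : d 0%nat = 0).
    { apply (Cmult_eq_0_reg_l am1 _ am1_neq).
      transitivity (- (am1 * (u 0%nat * d 1%nat - u 1%nat * d 0%nat)))%C;
        [unfold u; simpl; ring | rewrite W1; ring]. }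
    assert (D1 : d 1%nat = 0).
    { apply (Cmult_eq_0_reg_l am1 _ am1_neq).
      transitivity (am1 * (v 0%nat * d 1%nat - v 1%nat * d 0%nat))%C;
        [unfold v; simpl; ring | exact W2]. }
    assert (D : forall k, d k = 0 /\ d (S k) = 0).
    { induction k as [|k [I1 I2]]; [auto|]. split; [exact I2|].
      specialize (Hd k). rewrite I1, I2 in Hd.
      apply (Cmult_eq_0_reg_l (a k)).
      - intro Hz; apply RtoC_inj in Hz. specialize (a_pos k). lra.
      - transitivity (aprev am1 a k * 0 + b k * 0 + a k * d (S (S k)))%C; [ring|].
        rewrite Hd. ring. }
    apply functional_extensionality. intros k.
    destruct (D k) as [Dk _]. unfold d in Dk.
    transitivity (f k - g k + g k)%C; [ring|]. rewrite Dk. ring. }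
  assert (Hj : jost am1 a b N0 s lam = f).
  { symmetry. apply Huniq. unfold jost.
    assert (Hex : exists g, unique (is_jost am1 a b N0 s lam) g)
      by (exists f; split; assumption).
    exact (proj1 (epsilon_spec (inhabits (fun _ : nat => RtoC 0)) _ Hex)). }
  (* At index 0, that is [n = -1], [u] vanishes and [v] is 1, so [f 0 = h1 / am1]. *)
  rewrite OmegaE, Hj. unfold f, u, v; simpl. field. exact am1_neq.
Qed.

End OmegaLimit.

(** * Convergence of the amplitudes uniformly in the spectral parameter *)

Lemma alpha_lim (am1 : R) (a : nat -> R) :
  0 < am1 -> (forall n, 0 < a n) ->
  is_lim_seq a p_infty -> is_lim_seq (ratio am1 a) 1 ->
  is_lim_seq (alpha am1 a) 0.
Proof.
  intros H1 Ha Hinf Hr. apply is_lim_seq_incr_1.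
  apply (is_lim_seq_ext (fun n => / 2 * (ratio am1 a (S n) * / a n))).
  - intros n. unfold alpha, ratio. change (aprev am1 a (S n)) with (a n).
    pose proof (Ha n). pose proof (Ha (S n)).
    pose proof (sqrt_lt_R0 _ (Ha n)). pose proof (sqrt_lt_R0 _ (Ha (S n))).
    rewrite sqrt_mult by lra.
    rewrite <- (sqrt_sqrt (a n)) at 2 by lra. field. lra.
  - replace (Finite 0) with (Finite (/ 2 * (1 * 0))) by (f_equal; ring).
    apply is_lim_seq_mult'; [apply is_lim_seq_const|].
    apply is_lim_seq_mult'.
    + now apply -> is_lim_seq_incr_1.
    + apply (is_lim_seq_inv a p_infty Hinf). discriminate.
Qed.

(** Since [cos theta_n = alpha_n lam + beta_n], its increments are at most
    [rho0 |alpha_n'| + |beta_n'|]. Hence the coefficient in [recurrence_increment] has a summable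
    majorant free of [lam], and [N1] and [T] precede both [lam] and [u]. *)
Lemma amplitude_uniform (am1 : R) (a b : nat -> R) (N0 : nat) (rho0 m : R) :
  0 < am1 -> (forall n, 0 < a n) -> 0 < rho0 -> 0 < m ->
  ex_series (fun n => Rabs (alpha am1 a (S n) - alpha am1 a n)) ->
  ex_series (fun n => Rabs (beta am1 a b (S n) - beta am1 a b n)) ->
  ex_series (fun n => Rabs (kcoef am1 a n - 1)) ->
  (forall n lam, (N0 <= n)%nat -> Rabs lam < rho0 ->
     -1 < alpha am1 a n * lam + beta am1 a b n < 1 /\
     m <= sin (theta am1 a b n lam)) ->
  exists (N1 : nat) (T : nat -> R),
    (N0 <= N1)%nat /\ is_lim_seq T 0 /\
    forall lam u, Rabs lam < rho0 -> real_solution am1 a b lam u ->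
    exists h : C, forall n, (N1 <= n)%nat ->
      Cmod (amplitude am1 a b N0 Upper lam u n - h)
      <= Cmod (amplitude am1 a b N0 Upper lam u N1) * T n.
Proof.
  intros H1 Ha Hrho Hm HA HB HK Hx.
  assert (Hk : eventually (fun n => / 2 <= kcoef am1 a n)).
  { pose proof (ex_series_lim_0 _ HK) as Hl. apply is_lim_seq_spec in Hl.
    destruct (Hl (mkposreal (/ 2) ltac:(lra))) as [N HN]. simpl in HN.
    exists N. intros n Hn. specialize (HN n Hn).
    rewrite Rminus_0_r, Rabs_Rabsolu in HN. apply Rabs_lt_between in HN. lra. }
  destruct Hk as [Nk Hk].
  (* The coefficient of [recurrence_increment] for angles [theta_n] and [theta_{n+1}]; the
     recurrence linking [v_n], [v_{n+1}], [v_{n+2}] is the one at [n + 1], hence [kcoef] at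
     [S n]. *)
  set (e := fun n =>
    ((1 + / m) * (rho0 * Rabs (alpha am1 a (S n) - alpha am1 a n)
                  + Rabs (beta am1 a b (S n) - beta am1 a b n))
     + 6 * Rabs (kcoef am1 a (S n) - 1)) * / m).
  assert (Hm' : 0 < / m) by now apply Rinv_0_lt_compat.
  assert (He : ex_series e).
  { apply (ex_series_scal_r (/ m)).
    apply (ex_series_plus (V := R_NormedModule)).
    - apply (ex_series_scal (V := R_NormedModule) (1 + / m)).
      apply (ex_series_plus (V := R_NormedModule)); [|exact HB].
      now apply (ex_series_scal (V := R_NormedModule) rho0).
    - apply (ex_series_scal (V := R_NormedModule) 6).
      now apply -> (ex_series_incr_1 (fun n => Rabs (kcoef am1 a n - 1))). }
  assert (He0 : forall n, 0 <= e n).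
  { intros n. unfold e.
    pose proof (Rabs_pos (alpha am1 a (S n) - alpha am1 a n)).
    pose proof (Rabs_pos (beta am1 a b (S n) - beta am1 a b n)).
    pose proof (Rabs_pos (kcoef am1 a (S n) - 1)).
    apply Rmult_le_pos; [|lra]. apply Rplus_le_le_0_compat; [|lra].
    apply Rmult_le_pos; [lra|]. nra. }
  destruct (summable_primitive e He) as (E & L & HE & HL).
  (* Past [N0] the angles are controlled, and past [Nk] one has [k_n >= 1/2]. *)
  exists (N0 + Nk)%nat, (fun n => exp (L - E (N0 + Nk)%nat) * (2 * (L - E n))).
  split; [lia|]. split.
  { replace (Finite 0) with (Finite (exp (L - E (N0 + Nk)%nat) * (2 * (L - L))))
      by (f_equal; ring).
    do 2 (apply is_lim_seq_mult'; [apply is_lim_seq_const|]).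
    apply is_lim_seq_minus'; [apply is_lim_seq_const | exact HL]. }
  intros lam u Hlam Hu. apply (discrete_gronwall _ E L).
  - intros n. specialize (HE n). specialize (He0 n). lra.
  - exact HL.
  - intros n Hn. rewrite HE.
    destruct (Hx n lam ltac:(lia) Hlam) as [Hx1 Hs1].
    destruct (Hx (S n) lam ltac:(lia) Hlam) as [Hx2 Hs2].
    unfold amplitude, side_sign. rewrite phi_S, !Rmult_1_l by lia.
    set (p := phi am1 a b N0 n lam). set (t := theta am1 a b n lam) in *.
    set (t' := theta am1 a b (S n) lam) in *.
    set (V1 := scaled am1 a u (S n)). set (V2 := scaled am1 a u (S (S n))).
    set (V3 := scaled am1 a u (S (S (S n)))).
    replace (- (p + t)) with (- p + - t) by ring. rewrite expi_add.
    replace (expi (- p) * expi (- t) * (V3 - expi (- t') * V2)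
             - expi (- p) * (V2 - expi (- t) * V1))%C
      with (expi (- p) * (expi (- t) * (V3 - expi (- t') * V2)
                          - (V2 - expi (- t) * V1)))%C by ring.
    rewrite !Cmod_mult, !expi_mod, !Rmult_1_l.
    eapply Rle_trans;
      [apply (recurrence_increment t t' (kcoef am1 a (S n)) m); auto|].
    + apply Hk. lia.
    + unfold t', theta. rewrite cos_acos by lra.
      now apply scaled_recurrence.
    + apply Rmult_le_compat_r; [apply Cmod_ge_0|].
      unfold e. apply Rmult_le_compat_r; [lra|]. apply Rplus_le_compat_r.
      apply Rmult_le_compat_l; [lra|].
      unfold t, t', theta. rewrite !cos_acos by lra.
      replace (alpha am1 a (S n) * lam + beta am1 a b (S n)
               - (alpha am1 a n * lam + beta am1 a b n))
        with (lam * (alpha am1 a (S n) - alpha am1 a n)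
              + (beta am1 a b (S n) - beta am1 a b n)) by ring.
      eapply Rle_trans; [apply Rabs_triang|]. rewrite Rabs_mult.
      apply Rplus_le_compat_r, Rmult_le_compat_r; [apply Rabs_pos | lra].
Qed.

(** The limit of the amplitudes of the polynomials is [- Omega] by [Omega_limit], and conjugate
    amplitudes on the two edges give conjugate values of [Omega]. *)
Lemma amplitude_Omega (am1 : R) (a b : nat -> R) (N0 : nat) (rho0 m : R) :
  0 < am1 -> (forall n, 0 < a n) -> 0 < rho0 -> 0 < m ->
  ex_series (fun n => Rabs (alpha am1 a (S n) - alpha am1 a n)) ->
  ex_series (fun n => Rabs (beta am1 a b (S n) - beta am1 a b n)) ->
  ex_series (fun n => Rabs (kcoef am1 a n - 1)) ->
  is_lim_seq (ratio am1 a) 1 ->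
  (forall n lam, (N0 <= n)%nat -> Rabs lam < rho0 ->
     -1 < alpha am1 a n * lam + beta am1 a b n < 1 /\
     m <= sin (theta am1 a b n lam)) ->
  (forall lam, Rabs lam < rho0 ->
     Omega am1 a b N0 Lower (RtoC lam) = Cconj (Omega am1 a b N0 Upper (RtoC lam))) /\
  exists (N1 : nat) (T : nat -> R) (B : R),
    is_lim_seq T 0 /\ (N0 <= N1)%nat /\
    forall lam, Rabs lam < rho0 ->
      Cmod (Omega am1 a b N0 Upper (RtoC lam)) <= B /\
      forall n, (N1 <= n)%nat ->
      Cmod (amplitude am1 a b N0 Upper lam (sol am1 a b lam 0 1) n
            + Omega am1 a b N0 Upper (RtoC lam)) <= T n.
Proof.
  intros H1 Ha Hrho Hm HA HB HK Hr Hx.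
  destruct (amplitude_uniform am1 a b N0 rho0 m H1 Ha Hrho Hm HA HB HK Hx)
    as (N1 & T & HN1 & HT & Hunif).
  assert (Hconv : forall lam u, Rabs lam < rho0 -> real_solution am1 a b lam u ->
    exists h : C,
      (forall n, (N1 <= n)%nat ->
        Cmod (amplitude am1 a b N0 Upper lam u n - h)
        <= Cmod (amplitude am1 a b N0 Upper lam u N1) * T n) /\
      is_lim_seq (fun n => Cmod (amplitude am1 a b N0 Upper lam u n - h)) 0 /\
      is_lim_seq (fun n => Cmod (amplitude am1 a b N0 Lower lam u n - Cconj h)) 0).
  { intros lam u Hl Hu. destruct (Hunif lam u Hl Hu) as [h Hh]. exists h.
    assert (Hlim : is_lim_seq
      (fun n => Cmod (amplitude am1 a b N0 Upper lam u n - h)) 0).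
    { apply (is_lim_seq_dominated _
        (fun n => Cmod (amplitude am1 a b N0 Upper lam u N1) * T n)).
      - exists N1. intros n Hn. rewrite Rabs_pos_eq by apply Cmod_ge_0. auto.
      - replace (Finite 0)
          with (Finite (Cmod (amplitude am1 a b N0 Upper lam u N1) * 0))
          by (f_equal; ring).
        apply is_lim_seq_mult'; [apply is_lim_seq_const | exact HT]. }
    split; [exact Hh|]. split; [exact Hlim|].
    refine (is_lim_seq_ext _ _ _ _ Hlim). intros n.
    rewrite amplitude_conj, <- Cminus_conj. symmetry. apply Cmod_conj. }
  assert (HOm : forall lam, Rabs lam < rho0 ->
    Omega am1 a b N0 Lower (RtoC lam) = Cconj (Omega am1 a b N0 Upper (RtoC lam)) /\
    forall n, (N1 <= n)%nat ->
        Cmod (amplitude am1 a b N0 Upper lam (sol am1 a b lam 0 1) n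
              + Omega am1 a b N0 Upper (RtoC lam))
        <= Cmod (amplitude am1 a b N0 Upper lam (sol am1 a b lam 0 1) N1) * T n).
  { intros lam Hl.
    destruct (Hconv lam _ Hl (sol_solution am1 a b lam 0 1 Ha)) as (h1 & B1 & U1 & L1).
    destruct (Hconv lam _ Hl (sol_solution am1 a b lam 1 0 Ha)) as (h2 & B2 & U2 & L2).
    assert (Hx1 := fun n Hn => proj1 (Hx n lam Hn Hl)).
    assert (Hx2 := fun n Hn => proj2 (Hx n lam Hn Hl)).
    rewrite (Omega_limit am1 a b N0 lam m H1 Ha Hr Hx1 Hm Hx2 Upper h1 h2 U1 U2).
    rewrite (Omega_limit am1 a b N0 lam m H1 Ha Hr Hx1 Hm Hx2 Lower _ _ L1 L2).
    split; [symmetry; apply Copp_conj|].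
    exact B1. }
  split; [intros lam Hl; now apply HOm|].
  destruct (sol_bounded am1 a b 0 1 rho0 (S N1)) as [B1 HB1].
  destruct (sol_bounded am1 a b 0 1 rho0 (S (S N1))) as [B2 HB2].
  (* Bounds the amplitude at the fixed index [N1] for all [lam], removing the last dependence on
     [lam] from the rate. Comparing with the limit at [n = N1] then bounds [Omega] itself. *)
  set (B := sqrt (a (S N1)) * B2 + sqrt (a N1) * B1).
  assert (Hamp : forall lam, Rabs lam < rho0 ->
    Cmod (amplitude am1 a b N0 Upper lam (sol am1 a b lam 0 1) N1) <= B).
  { intros lam Hl. unfold amplitude. rewrite Cmod_mult, expi_mod, Rmult_1_l.
    eapply Rle_trans; [apply Cmod_triangle|].
    rewrite Cmod_opp, Cmod_mult, expi_mod, Rmult_1_l, !Cmod_R.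
    unfold scaled. rewrite !Rabs_mult.
    change (aprev am1 a (S (S N1))) with (a (S N1)).
    change (aprev am1 a (S N1)) with (a N1).
    rewrite !(Rabs_pos_eq (sqrt _)) by apply sqrt_pos.
    apply Rplus_le_compat; apply Rmult_le_compat_l; auto using sqrt_pos. }
  assert (HT' : forall lam n, Rabs lam < rho0 -> (N1 <= n)%nat ->
    Cmod (amplitude am1 a b N0 Upper lam (sol am1 a b lam 0 1) n
          + Omega am1 a b N0 Upper (RtoC lam)) <= B * Rabs (T n)).
  { intros lam n Hl Hn. eapply Rle_trans; [now apply HOm|].
    eapply Rle_trans; [|apply Rmult_le_compat_r; [apply Rabs_pos | exact (Hamp lam Hl)]].
    apply Rmult_le_compat_l; [apply Cmod_ge_0 | apply Rle_abs]. }
  exists N1, (fun n => B * Rabs (T n)), (B + B * Rabs (T N1)).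
  split.
  { replace (Finite 0) with (Finite (B * 0)) by (f_equal; ring).
    apply is_lim_seq_mult'; [apply is_lim_seq_const|].
    now apply (is_lim_seq_abs_0 T). }
  split; [exact HN1|].
  intros lam Hl. split; [|intros n Hn; now apply HT'].
  specialize (HT' lam N1 Hl (Nat.le_refl _)). specialize (Hamp lam Hl).
  set (w := amplitude am1 a b N0 Upper lam (sol am1 a b lam 0 1) N1) in *.
  replace (Omega am1 a b N0 Upper lam)
    with (- w + (w + Omega am1 a b N0 Upper lam))%C by ring.
  eapply Rle_trans; [apply Cmod_triangle|]. rewrite Cmod_opp. lra.
Qed.

(** * The phase and the asymptotics of the polynomials *)

(** For each [lam] an angle of [- Omega] on the upper edge is chosen; conjugation carries the
    relation to the lower edge. *)
Lemma is_phase_exists (am1 : R) (a b : nat -> R) (N0 : nat) (rho0 : R) :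
  (forall lam, Rabs lam < rho0 ->
     Omega am1 a b N0 Lower (RtoC lam) = Cconj (Omega am1 a b N0 Upper (RtoC lam))) ->
  exists eta : R -> R, is_phase am1 a b N0 rho0 eta.
Proof.
  intros Hc.
  set (arg := fun lam t =>
    (- Omega am1 a b N0 Upper (RtoC lam)
     = RtoC (kappa am1 a b N0 lam) * expi t)%C).
  exists (fun lam => epsilon (inhabits 0) (arg lam)).
  intros s lam Hl.
  assert (Hex : exists t, arg lam t).
  { destruct (polar_form (- Omega am1 a b N0 Upper (RtoC lam))) as [t Ht].
    exists t. unfold arg, kappa. now rewrite Cmod_opp in Ht. }
  apply (epsilon_spec (inhabits 0)) in Hex. set (t := epsilon _ _) in *.
  unfold arg in Hex. destruct s; unfold side_sign.
  - now rewrite Rmult_1_l.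
  - rewrite (Hc lam Hl), <- Copp_conj, Hex, Cmult_conj, expi_conj.
    replace (-1 * t) with (- t) by ring. f_equal.
    unfold Cconj, RtoC; simpl. now rewrite Ropp_0.
Qed.

(** Two errors add up: the amplitude differs from its limit [w], and dividing by [sin theta_n]
    differs from dividing by the limiting [sin t]. Here [w] stands for [- Omega] and [t] for
    [acos beta_inf]. *)
Lemma asymptotics_error (am1 : R) (a b : nat -> R) (N0 n : nat)
    (lam m t k eta : R) (w : C) :
  0 < m -> m <= sin (theta am1 a b n lam) -> m <= sin t ->
  w = (RtoC k * expi eta)%C ->
  Rabs (scaled am1 a (sol am1 a b lam 0 1) (S n)
        - k * / sin t * sin (phi am1 a b N0 n lam + eta))
  <= / m * Cmod (amplitude am1 a b N0 Upper lam (sol am1 a b lam 0 1) n - w)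
     + Cmod w * (/ m * / m * / m
                 * Rabs (cos (theta am1 a b n lam) - cos t)).
Proof.
  intros Hm Hs Ht Hw.
  set (u := sol am1 a b lam 0 1). set (p := phi am1 a b N0 n lam).
  set (H := amplitude am1 a b N0 Upper lam u n).
  set (s := theta am1 a b n lam) in *.
  assert (E1 : scaled am1 a u (S n) * sin s = Im (expi p * H))
    by apply scaled_eq_amplitude.
  assert (E2 : k * sin (p + eta) = Im (expi p * w)).
  { rewrite Hw. replace (expi p * (k * expi eta))%C with (k * expi (p + eta))%C
      by (rewrite expi_add; ring). unfold expi; simpl. ring. }
  assert (E3 : Im (expi p * H) = Im (expi p * (H - w)) + Im (expi p * w)).
  { transitivity (Im (expi p * (H - w) + expi p * w)); [f_equal; ring | reflexivity]. }
  assert (E : scaled am1 a u (S n) - k * / sin t * sin (p + eta)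
    = / sin s * Im (expi p * (H - w))
      + Im (expi p * w) * (/ sin s * / sin t * (sin t - sin s))).
  { transitivity (/ sin s * (scaled am1 a u (S n) * sin s)
      - / sin t * (k * sin (p + eta))); [field; lra|].
    rewrite E1, E2, E3. field. lra. }
  rewrite E. eapply Rle_trans; [apply Rabs_triang|]. rewrite !Rabs_mult.
  assert (Hinv : forall x, m <= x -> 0 <= Rabs (/ x) <= / m).
  { intros x Hx. split; [apply Rabs_pos|].
    rewrite Rabs_pos_eq by (apply Rlt_le, Rinv_0_lt_compat; lra).
    apply Rinv_le_contravar; lra. }
  pose proof (Hinv _ Hs) as [I1 I2]. pose proof (Hinv _ Ht) as [J1 J2].
  assert (HIm : forall z, Rabs (Im (expi p * z)) <= Cmod z).
  { intros z. rewrite <- (Rmult_1_l (Cmod z)), <- (expi_mod p), <- Cmod_mult.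
    apply im_le_Cmod. }
  apply Rplus_le_compat.
  - apply Rmult_le_compat; auto using Rabs_pos.
  - apply Rmult_le_compat; auto using Rabs_pos.
    + repeat apply Rmult_le_pos; auto using Rabs_pos.
    + rewrite (Rmult_assoc (/ m * / m)). apply Rmult_le_compat.
      * apply Rmult_le_pos; auto.
      * apply Rabs_pos.
      * apply Rmult_le_compat; auto.
      * rewrite Rabs_minus_sym, (Rabs_minus_sym (cos s)), (Rabs_minus_sym (sin s)).
        now apply Rabs_sin_minus_le.
Qed.

Theorem theorem5p5 :
  forall (am1 : R) (a b : nat -> R) (beta_inf : R),
    0 < am1 ->
    (forall n : nat, 0 < a n) ->
    is_lim_seq a p_infty ->
    is_lim_seq (beta am1 a b) beta_inf ->
    Rabs beta_inf < 1 ->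
    ex_series (fun n => Rabs (alpha am1 a (S n) - alpha am1 a n)) ->
    ex_series (fun n => Rabs (beta am1 a b (S n) - beta am1 a b n)) ->
    ex_series (fun n => Rabs (kcoef am1 a n - 1)) ->
    is_lim_seq (sum_n (fun n => / a n)) p_infty ->
  forall (rho0 eps0 : R) (N0 : nat),
    0 < rho0 ->
    0 < eps0 < 1 - Rabs beta_inf ->
    (1 <= N0)%nat ->
    (forall (n : nat) (z : C), (N0 <= n)%nat -> Cmod z < rho0 ->
       Cmod (alpha am1 a n * z + beta am1 a b n - beta_inf)%C < eps0) ->
  (exists eta : R -> R, is_phase am1 a b N0 rho0 eta) /\
  (forall eta : R -> R, is_phase am1 a b N0 rho0 eta ->
   exists r : nat -> R -> R,
     (forall (n : nat) (lam : R), Rabs lam < rho0 ->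
        P am1 a b n (RtoC lam) =
        RtoC (/ sqrt (a n) *
              (kappa am1 a b N0 lam * / sqrt (1 - beta_inf ^ 2)
                 * sin (phi am1 a b N0 n lam + eta lam)
               + r n lam))) /\
     (forall c d : R, - rho0 < c -> c <= d -> d < rho0 ->
      forall eps : R, 0 < eps ->
      exists M : nat, forall (n : nat) (lam : R),
        (M <= n)%nat -> c <= lam <= d -> Rabs (r n lam) < eps)).
Proof.
  intros am1 a b beta_inf H1 Ha Hinf Hbeta Hb1 HA HB HK Hcar rho0 eps0 N0
    Hrho Heps HN0 Hx.
  pose proof (ratio_lim am1 a H1 Ha Hinf HK Hcar) as Hr.
  (* The choice of [N0] keeps [|alpha_n lam + beta_n|] below [M < 1], so all [sin theta_n] are at
     least [m = sqrt (1 - M^2)]. *)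
  set (M := Rabs beta_inf + eps0).
  assert (HM : 0 <= M < 1) by (unfold M; generalize (Rabs_pos beta_inf); lra).
  set (m := sqrt (1 - Rsqr M)).
  assert (HM2 : Rsqr M < 1) by (unfold Rsqr; nra).
  assert (Hm : 0 < m) by (apply sqrt_lt_R0; lra).
  assert (Hsin : forall x, Rabs x <= M -> -1 < x < 1 /\ m <= sin (acos x)).
  { intros x HxM. assert (Hx1 : -1 < x < 1) by (apply Rabs_le_between in HxM; lra).
    split; [exact Hx1|]. rewrite sin_acos by lra.
    apply sqrt_le_1_alt. rewrite (Rsqr_abs x).
    pose proof (Rabs_pos x). unfold Rsqr. nra. }
  assert (Hxn : forall n lam, (N0 <= n)%nat -> Rabs lam < rho0 ->
    Rabs (alpha am1 a n * lam + beta am1 a b n - beta_inf) < eps0).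
  { intros n lam Hn Hl. rewrite <- Cmod_R, RtoC_minus, RtoC_plus, RtoC_mult.
    apply Hx; [exact Hn | now rewrite Cmod_R]. }
  assert (Hth : forall n lam, (N0 <= n)%nat -> Rabs lam < rho0 ->
     -1 < alpha am1 a n * lam + beta am1 a b n < 1 /\
     m <= sin (theta am1 a b n lam)).
  { intros n lam Hn Hl. apply Hsin. specialize (Hxn n lam Hn Hl).
    replace (alpha am1 a n * lam + beta am1 a b n)
      with (beta_inf + (alpha am1 a n * lam + beta am1 a b n - beta_inf)) by ring.
    eapply Rle_trans; [apply Rabs_triang|]. unfold M. lra. }
  destruct (Hsin beta_inf ltac:(unfold M; lra)) as [Hbi Hbs].
  destruct (amplitude_Omega am1 a b N0 rho0 m H1 Ha Hrho Hm HA HB HK Hr Hth)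
    as (Hconj & N1 & T & B & HT & HN1 & Hamp).
  split; [now apply is_phase_exists|].
  intros eta Heta.
  (* The remainder is obtained by solving the claimed identity for it, so the content lies in its
     uniform decay. *)
  exists (fun n lam => scaled am1 a (sol am1 a b lam 0 1) (S n)
    - kappa am1 a b N0 lam * / sqrt (1 - beta_inf ^ 2)
      * sin (phi am1 a b N0 n lam + eta lam)).
  split.
  - intros n lam _. unfold P. rewrite Psol_real by exact Ha. f_equal.
    unfold scaled. change (aprev am1 a (S n)) with (a n).
    pose proof (sqrt_lt_R0 _ (Ha n)) as Hs.
    transitivity (/ sqrt (a n) * (sqrt (a n) * sol am1 a b lam 0 1 (S n)));
      [field; lra | f_equal; ring].
  - intros c d Hc Hcd Hd eps Hepspos.
    (* A majorant of the right side of [asymptotics_error] free of [lam]: [T] bounds the amplitude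
       error, [B] bounds [Omega], and the last factor bounds [|cos theta_n - beta_inf|]. *)
    assert (HW : is_lim_seq (fun n => / m * T n + B * (/ m * / m * / m
      * (rho0 * Rabs (alpha am1 a n) + Rabs (beta am1 a b n - beta_inf)))) 0).
    { replace (Finite 0) with (Finite (/ m * 0 + B * (/ m * / m * / m
        * (rho0 * 0 + 0)))) by (f_equal; ring).
      apply is_lim_seq_plus'.
      - apply is_lim_seq_mult'; [apply is_lim_seq_const | exact HT].
      - do 2 (apply is_lim_seq_mult'; [apply is_lim_seq_const|]).
        apply is_lim_seq_plus'.
        + apply is_lim_seq_mult'; [apply is_lim_seq_const|].
          apply (is_lim_seq_abs_0 (alpha am1 a)). now apply alpha_lim.
        + apply (is_lim_seq_abs_0 (fun n => beta am1 a b n - beta_inf)).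
          replace (Finite 0) with (Finite (beta_inf - beta_inf)) by (f_equal; ring).
          apply is_lim_seq_minus'; [exact Hbeta | apply is_lim_seq_const]. }
    apply is_lim_seq_spec in HW.
    destruct (HW (mkposreal eps Hepspos)) as [N2 HN2]. simpl in HN2.
    exists (N1 + N2)%nat. intros n lam Hn Hl.
    assert (Hlam : Rabs lam < rho0) by (apply Rabs_def1; lra).
    destruct (Hamp lam Hlam) as [HBd HTn].
    specialize (HTn n ltac:(lia)). specialize (HN2 n ltac:(lia)).
    rewrite Rminus_0_r in HN2.
    destruct (Hth n lam ltac:(lia) Hlam) as [Hx1 Hs1].
    assert (Hw : (- Omega am1 a b N0 Upper lam
                  = kappa am1 a b N0 lam * expi (eta lam))%C).
    { rewrite <- (Rmult_1_l (eta lam)). exact (Heta Upper lam Hlam). }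
    pose proof (asymptotics_error am1 a b N0 n lam m (acos beta_inf)
      _ _ _ Hm Hs1 Hbs Hw) as Herr.
    replace (sqrt (1 - beta_inf ^ 2)) with (sin (acos beta_inf))
      by (rewrite sin_acos by lra; f_equal; unfold Rsqr; ring).
    eapply Rle_lt_trans; [exact Herr|].
    eapply Rle_lt_trans; [|eapply Rle_lt_trans; [apply Rle_abs | exact HN2]].
    assert (Hmi : 0 < / m) by now apply Rinv_0_lt_compat.
    rewrite Cmod_opp. apply Rplus_le_compat.
    + apply Rmult_le_compat_l; [lra|].
      eapply Rle_trans; [|exact HTn]. apply Req_le. f_equal. ring.
    + apply Rmult_le_compat; [apply Cmod_ge_0 | | exact HBd |].
      * repeat apply Rmult_le_pos; try lra. apply Rabs_pos.
      * apply Rmult_le_compat_l; [repeat apply Rmult_le_pos; lra|].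
        unfold theta. rewrite !cos_acos by lra.
        replace (alpha am1 a n * lam + beta am1 a b n - beta_inf)
          with (lam * alpha am1 a n + (beta am1 a b n - beta_inf)) by ring.
        eapply Rle_trans; [apply Rabs_triang|]. rewrite Rabs_mult.
        apply Rplus_le_compat_r, Rmult_le_compat_r; [apply Rabs_pos | lra].
Qed.
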